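(* Let $\mathcal{G}=\mathrm{Diff}_{+\mathrm{ar}}(\overline{D^2})_0$ and $\mathcal{H}=\{g\in\mathcal{G}: g|_{S^1}=\mathrm{id}_{S^1}\}$. Then $\mathcal{H}$ is a closed normal subgroup of $\mathcal{G}$, and the natural map $$\mathcal{G}/\mathcal{H}\longrightarrow\mathrm{Diff}_+(S^1),\qquad g\mathcal{H}\longmapsto g|_{S^1},$$ is an isomorphism of groups.
   Context: $D^2$ is the open unit disc in $\mathbb{C}$, $S^1=\partial D^2$, $\overline{D^2}=D^2\cup S^1$. $\mathrm{Diff}_+(M)$ is the group of orientation-preserving $C^\infty$ self-diffeomorphisms of $M$ (with its usual $C^\infty$ topology). An element $g\in\mathrm{Diff}_+(\overline{D^2})$ is asymptotically radial if there exist $\epsilon\in(0,1)$ and $f\in\mathrm{Diff}_+(S^1)$, written in the angular coordinate as $f:\mathbb{R}/2\pi\mathbb{Z}\to\mathbb{R}/2\pi\mathbb{Z}$, such that $g(re^{\mathrm{i}\theta})=re^{\mathrm{i}f(\theta)}$ for all $r\in(1-\epsilon,1]$ and all $\theta$. $\mathrm{Diff}_{+\mathrm{ar}}(\overline{D^2})$ is the group of all such elements. $\mathrm{Diff}_{+\mathrm{ar}}(\overline{D^2})_0$ is the subgroup of those $g$ that are smoothly isotopic to the identity within it: there is a smooth $H:\overline{D^2}\times[0,1]\to\overline{D^2}$ with $H(\cdot,t)\in\mathrm{Diff}_{+\mathrm{ar}}(\overline{D^2})$ for all $t$, $H(\cdot,0)=\mathrm{id}$, $H(\cdot,1)=g$.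 *)

(* Defs.v *)
From HB Require Import structures.
From mathcomp Require Import all_boot all_order all_algebra.
From mathcomp Require Import all_classical all_reals all_analysis.
Import Order.TTheory GRing.Theory Num.Theory.
Import numFieldNormedType.Exports.

Set Implicit Arguments.
Unset Strict Implicit.
Unset Printing Implicit Defensive.

Local Open Scope classical_set_scope.
Local Open Scope ring_scope.

(* The group of all self-bijections of T; (g * h) x = g (h x). *)
Record sym (T : Type) : Type := Sym {
  sym_fun :> T -> T;
  sym_inv : T -> T;
  sym_funK : cancel sym_fun sym_inv;
  sym_invK : cancel sym_inv sym_fun }.

Lemma sym_eq (T : Type) (g h : sym T) : g =1 h -> g = h.
Proof.
case: g => f f' fK f'K; case: h => k k' kK k'K /= /funext E.
subst k; have E' : f' = k'.
  by apply/funext => x; rewrite -[in RHS](f'K x) kK.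
by subst k'; congr Sym; exact: Prop_irrelevance.
Qed.

HB.instance Definition _ (T : Type) := gen_eqMixin (sym T).
HB.instance Definition _ (T : Type) := gen_choiceMixin (sym T).

Section SymGroup.
Variable T : Type.

Definition sym_one : sym T :=
  @Sym T id id (fun _ => erefl) (fun _ => erefl).

Definition sym_V (g : sym T) : sym T := Sym (@sym_invK T g) (@sym_funK T g).

Definition sym_mul (g h : sym T) : sym T :=
  Sym (can_comp (@sym_funK T g) (@sym_funK T h))
      (can_comp (@sym_invK T h) (@sym_invK T g)).

Lemma sym_mulA : associative sym_mul.
Proof. by move=> f g h; apply: sym_eq. Qed.

Lemma sym_mul1g : left_id sym_one sym_mul.
Proof. by move=> g; apply: sym_eq. Qed.

Lemma sym_mulg1 : right_id sym_one sym_mul.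
Proof. by move=> g; apply: sym_eq. Qed.

Lemma sym_mulVg : left_inverse sym_one sym_V sym_mul.
Proof. by move=> g; apply: sym_eq => x /=; exact: sym_funK. Qed.

Lemma sym_mulgV : right_inverse sym_one sym_V sym_mul.
Proof. by move=> g; apply: sym_eq => x /=; exact: sym_invK. Qed.

HB.instance Definition _ := isGroup.Build (sym T)
  sym_mulA sym_mul1g sym_mulg1 sym_mulVg sym_mulgV.

End SymGroup.

Section Cosets.
Variable G : groupType.
Implicit Types (A B K N : set G) (g : G).

Definition subgroup K : Prop := group_closed (mem K).

Definition normal_subgroup N K : Prop :=
  [/\ subgroup N, N `<=` K &
      forall g n, K g -> N n -> N (g * n * g^-1)%g].

Definition setmul A B : set G := [set (a * b)%g | a in A & b in B].

Definition left_coset g N : set G := [set (g * n)%g | n in N].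

(* K / N as a set of cosets; its group law is setmul, since
   setmul (g N) (g' N) = (g g') N when N is normal. *)
Definition quotient_set K N : set (set G) := [set left_coset g N | g in K].

End Cosets.

Section Smooth.
Variables (R : realType) (V W : normedModType R).

Definition iter_diff (vs : seq V) (F : V -> W) : V -> W :=
  foldl (fun (F : V -> W) v => fun x => 'd F x v) F vs.

(* C^oo on an open set U of the (finite-dimensional) space V. *)
Definition smooth_on (U : set V) (F : V -> W) : Prop :=
  forall vs x, U x -> differentiable (iter_diff vs F) x.

Section Subspace.
Variables (T : Type) (i : T -> V).

(* T is viewed as a subset of V through the injection i: F is a C^oo
   function on a neighbourhood of i x in V which extends f : T -> W. *)
Definition local_extension (f : T -> W) (x : T) (F : V -> W) : Prop :=
  exists U : set V, [/\ open U, U (i x), smooth_on U F &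
    forall y, U (i y) -> F (i y) = f y].

Definition smooth (f : T -> W) : Prop :=
  forall x, exists F, local_extension f x F.

(* Iterated differential of f at x along vs, computed on some local extension.
   If i @` T lies in the closure of its interior, as for a closed disc, all
   local extensions give the same value. *)
Definition deriv_along (vs : seq V) (f : T -> W) (x : T) : W :=
  iter_diff vs (xget (fun=> 0) (local_extension f x)) (i x).

End Subspace.
End Smooth.

Section Diffeo.
Variable R : realType.
Notation plane := 'rV[R]_2.

(* The norm of 'rV is the sup norm, hence the explicit Euclidean equations. *)
Definition cdisc : set plane := [set p | p 0 0 ^+ 2 + p 0 1 ^+ 2 <= 1].

Definition circle : set plane := [set p | p 0 0 ^+ 2 + p 0 1 ^+ 2 = 1].

Definition diffeo (A : set plane) (g : sym A) : Prop :=
  smooth set_val (fun x => set_val (g x)) /\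
  smooth set_val (fun x => set_val (sym_inv g x)).

Definition Diffp_disc : set (sym cdisc) := [set g | diffeo g /\
  forall x F, local_extension set_val (fun y => set_val (g y)) x F ->
    0 < \det (jacobian F (set_val x))].

(* Multiplication by the imaginary unit: rot z is the unit vector d/dtheta
   tangent to the circle at z. *)
Definition rot (z : plane) : plane :=
  \row_j (if j == 0 then - z 0 1 else z 0 0).

Definition dotp (u v : plane) : R := \sum_j u 0 j * v 0 j.

(* The derivative of the angular coordinate of g at z is the component of
   dg_z(rot z) along rot (g z). *)
Definition Diffp_circle : set (sym circle) := [set g | diffeo g /\
  forall z F, local_extension set_val (fun y => set_val (g y)) z F ->
    0 < dotp ('d F (set_val z) (rot (set_val z))) (rot (set_val (g z)))].

(* g (r z) = r f(z): with z = e^(i theta) in the circle, f(z) is e^(i f(theta))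
   in the angular coordinate. *)
Definition radial_at (r : R) (g : sym cdisc) (f : sym circle) : Prop :=
  forall (x : cdisc) (z : circle),
    set_val x = r *: set_val z -> set_val (g x) = r *: set_val (f z).

Definition Diff_ar : set (sym cdisc) := [set g | Diffp_disc g /\
  exists (eps : R) (f : sym circle), [/\ 0 < eps < 1, Diffp_circle f &
    forall r, 1 - eps < r <= 1 -> radial_at r g f]].

Definition unit_interval : set R := [set t | 0 <= t <= 1].

Definition Diff_ar0 : set (sym cdisc) := [set g | Diff_ar g /\
  exists H : unit_interval -> sym cdisc,
    [/\ smooth (fun xt : cdisc * unit_interval =>
                  (set_val xt.1, set_val xt.2) : plane * R)
               (fun xt => set_val (H xt.2 xt.1)),
        forall t, Diff_ar (H t),
        forall t, set_val t = 0 -> H t = 1%g &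
        forall t, set_val t = 1 -> H t = g]].

Definition boundary_fixing : set (sym cdisc) := [set g | Diff_ar0 g /\
  forall x : cdisc, circle (set_val x) -> g x = x].

Definition restricts_to_circle (g : sym cdisc) (f : sym circle) : Prop :=
  forall (x : cdisc) (z : circle),
    set_val x = set_val z -> set_val (g x) = set_val (f z).

Definition jets (g : sym cdisc) :
    prod_topology (fun _ : seq plane => {uniform cdisc -> plane}) :=
  fun vs => deriv_along set_val vs (fun y => set_val (g y)).

(* Uniform convergence on the closed disc of all iterated derivatives; this is
   the C^oo topology on the subsets of Diffp_disc. *)
Definition cinfty_disc : topologicalType := initial_topology jets.

Definition closed_in (K N : set cinfty_disc) : Prop :=
  exists2 C : set cinfty_disc, closed C & N = K `&` C.

End Diffeo.
Arguments cdisc : clear implicits.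
Arguments circle : clear implicits.
Arguments Diffp_circle : clear implicits.
Arguments Diff_ar0 : clear implicits.
Arguments boundary_fixing : clear implicits.

(* Main.v *)
(* Boundary values of asymptotically radial diffeomorphisms multiply, so only
   surjectivity has content. A diffeomorphism f of the circle is written in the
   angular coordinate as a lift phi, obtained by integrating the angular speed of
   f, and u = phi - id is 2 pi-periodic. With a smooth step s that vanishes near 0
   and equals 1 near 1, the maps
     p |-> e^(i t s(|p|^2) u(arg p)) p      (0 <= t <= 1)
   of the plane preserve the norm, act on the circle of radius r as the convex
   combination of id and phi with weight t s(r^2), and join the identity to a
   diffeomorphism extending f. Their Jacobian determinant is the derivative of
   that convex combination, hence positive; smoothness of the inverses follows
   by bootstrapping d(g^-1) = (dg)^-1 o g^-1. *)
Require Import Defs.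
From HB Require Import structures.
From mathcomp Require Import all_boot all_order all_algebra.
From mathcomp Require Import all_classical all_reals all_analysis.
From mathcomp Require Import ring lra.
Import Order.TTheory GRing.Theory Num.Theory.
Import numFieldNormedType.Exports.

Set Implicit Arguments.
Unset Strict Implicit.
Unset Printing Implicit Defensive.

Local Open Scope classical_set_scope.
Local Open Scope ring_scope.

(* [seq.rot] shadows the rotation of the plane. *)
Local Notation rot := Defs.rot.

(** * Smooth maps *)

(** Smoothness on the disc or the circle means that local extensions exist, while the orientation
    conditions quantify over all of them. They are therefore first shown not to depend on the
    extension: on the disc, convexity determines the whole differential; on the circle, only the
    tangent direction is tested, and values along the circle determine it. The map extending [f]
    lives on the whole plane, so that one global formula serves as extension on the disc, on the
    circle and on the cylinder of the isotopy. The cut-off uses |p|^2, which is smooth at the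
    origin, and vanishes where arg p has no meaning. Preservation of the norm reduces bijectivity to
    the monotonicity of functions of one variable, and confines the inverse to a compact set; this
    gives its continuity, without which the bootstrap cannot start. The periodicity of [u] is where
    injectivity of [f] enters: it forces degree one. Calculus is carried out at finite order,
    because the product and chain rules go by induction on the order. *)

Section Calculus.
Variable R : realType.
Implicit Types V W Z : normedModType R.

Lemma diff_near_eq V W (F G : V -> W) x :
  (\forall y \near x, F y = G y) -> differentiable F x ->
  is_diff x G ('d F x).
Proof.
move=> FG dF.
have key : G \o shift x = cst (G x) + 'd F x +o_ 0 id.
  apply/eqaddoP => e e0.
  have /eqaddoP/(_ e e0) H := diff_locally dF.
  have Gx : G x = F x by rewrite (nbhs_singleton FG).
  have FG' : \forall y \near (0 : V), F (y + x) = G (y + x).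
    by move: FG; rewrite (near_shift 0 x); apply: filterS => y /=; rewrite subr0.
  by apply: filterS2 H FG' => y /=; rewrite !fctE /= Gx => + <-.
have dGE : 'd G x = 'd F x :> (V -> W).
  by apply: diff_unique => //; exact: diff_continuous.
apply: DiffDef => //.
by apply/diff_locallyP; rewrite dGE; split => //; exact: diff_continuous.
Qed.

(** Finite-order version of [smooth_on], made for induction: [k] counts how many times
    differentiation is possible, so [Cn 0] holds of every map and [Cn 1] is differentiability on
    [U]. *)
Definition Cn V W (k : nat) (U : set V) (F : V -> W) : Prop :=
  forall vs x, (size vs < k)%N -> U x -> differentiable (iter_diff vs F) x.

Lemma smooth_onP V W (U : set V) (F : V -> W) :
  smooth_on U F <-> forall k, Cn k U F.
Proof.
split=> [sF k vs x _ Ux|H vs x Ux]; first exact: sF.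
exact: (H (size vs).+1).
Qed.

Lemma CnS V W k (U : set V) (F : V -> W) :
  Cn k.+1 U F <-> (forall x, U x -> differentiable F x) /\
                  (forall v, Cn k U (fun x => 'd F x v)).
Proof.
split=> [H|[H0 H1] [|v vs] x /=].
- split=> [x Ux|v vs x s Ux]; first exact: (H [::]).
  exact: (H (v :: vs)).
- by move=> _ Ux; exact: H0.
- by rewrite ltnS => s Ux; exact: H1.
Qed.

Lemma CnW V W k (U : set V) (F : V -> W) : Cn k.+1 U F -> Cn k U F.
Proof. by move=> H vs x s; apply: H; exact: ltnW. Qed.

Lemma Cn0 V W (U : set V) (F : V -> W) : Cn 0 U F.
Proof. by []. Qed.

Lemma eq_Cn V W k (U : set V) (F G : V -> W) : open U ->
  (forall x, U x -> F x = G x) -> Cn k U F -> Cn k U G.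
Proof.
move=> oU; elim: k F G => // k IH F G FG /CnS[F0 F1].
have dG x : U x -> is_diff x G ('d F x).
  move=> Ux; apply: diff_near_eq; last exact: F0.
  by near=> y; apply: FG; near: y; exact: open_nbhs_nbhs.
apply/CnS; split=> [x /dG[]//|v].
by apply: IH (F1 v) => x /dG[_ ->].
Unshelve. all: by end_near. Qed.

(** The form in which every induction step below is made: an explicit formula for the differential,
    itself of order [k], raises the order by one. *)
Lemma CnS_diff V W k (U : set V) (F : V -> W) (D : V -> V -> W) : open U ->
  (forall x, U x -> is_diff x F (D x)) ->
  (forall v, Cn k U (fun x => D x v)) -> Cn k.+1 U F.
Proof.
move=> oU dF HD; apply/CnS; split=> [x /dF[]//|v].
by apply: eq_Cn (HD v) => // x /dF[_ ->].
Qed.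

Lemma Cn_cst V W k (U : set V) (w : W) : open U -> Cn k U (fun=> w).
Proof.
move=> oU; elim: k w => // k IH w.
by apply: (@CnS_diff _ _ _ _ _ (fun _ _ => 0)).
Qed.

Lemma CnD V W k (U : set V) (F G : V -> W) : open U ->
  Cn k U F -> Cn k U G -> Cn k U (fun x => F x + G x).
Proof.
move=> oU; elim: k F G => // k IH F G /CnS[F0 F1] /CnS[G0 G1].
apply: (@CnS_diff _ _ _ _ _ (fun x v => 'd F x v + 'd G x v)) => // x Ux.
  have dF := differentiableP (F0 _ Ux); have dG := differentiableP (G0 _ Ux).
  exact: (is_diffD dF dG).
exact: IH.
Qed.

Lemma Cn_sum V W k (U : set V) (I : Type) (r : seq I) (F : I -> V -> W) :
  open U -> (forall i, Cn k U (F i)) -> Cn k U (fun x => \sum_(i <- r) F i x).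
Proof.
move=> oU H; elim: r => [|i r IH].
  by under eq_fun do rewrite big_nil; exact: Cn_cst.
by under eq_fun do rewrite big_cons; exact: CnD.
Qed.

Lemma Cn_linear V W Z k (U : set V) (L : {linear W -> Z}) (F : V -> W) :
  open U -> continuous L -> Cn k U F -> Cn k U (fun x => L (F x)).
Proof.
move=> oU cL; elim: k F => // k IH F /CnS[F0 F1].
apply: (@CnS_diff _ _ _ _ _ (fun x v => L ('d F x v))) => // x Ux.
  have dF := differentiableP (F0 _ Ux).
  have dL : is_diff (F x) L L.
    by apply: DiffDef; [exact: linear_differentiable|exact: diff_lin].
  exact: (is_diff_comp dF dL).
exact: IH.
Qed.

Lemma Cn_id V k (U : set V) : open U -> Cn k U (fun x : V => x).
Proof.
move=> oU; case: k => // k.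
apply: (@CnS_diff _ _ _ _ _ (fun _ v => v)) => //.
by move=> v; exact: Cn_cst.
Qed.

Lemma CnM V k (U : set V) (F G : V -> R) : open U ->
  Cn k U F -> Cn k U G -> Cn k U (fun x => F x * G x).
Proof.
move=> oU; elim: k F G => // k IH F G Fk Gk.
have /CnS[F0 F1] := Fk; have /CnS[G0 G1] := Gk.
apply: (@CnS_diff _ _ _ _ _ (fun x v => F x * 'd G x v + G x * 'd F x v)) => //.
  move=> x Ux.
  have dF := differentiableP (F0 _ Ux); have dG := differentiableP (G0 _ Ux).
  exact: (is_diffM dF dG).
by move=> v; apply: CnD => //; apply: IH => //; exact: CnW.
Qed.

(** Continuous linear coordinates from which each vector is rebuilt. Being a class, it is inferred
    for the line, for rows and for products. *)
Class fin_dim (W : normedModType R) : Prop := FinDim {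
  fin_dim_basis : exists (I : finType) (e : I -> W) (c : I -> {linear W -> R}),
    (forall i, continuous (c i)) /\ forall w, w = \sum_i c i w *: e i }.

Lemma fst_linear V W : linear (fun p : V * W => p.1).
Proof. by []. Qed.

Lemma snd_linear V W : linear (fun p : V * W => p.2).
Proof. by []. Qed.

Definition fst_lin V W : {linear (V * W)%type -> V} :=
  HB.pack (fun p : V * W => p.1) (GRing.isLinear.Build _ _ _ _ _ (@fst_linear V W)).
Definition snd_lin V W : {linear (V * W)%type -> W} :=
  HB.pack (fun p : V * W => p.2) (GRing.isLinear.Build _ _ _ _ _ (@snd_linear V W)).

Lemma coord_linear n (j : 'I_n) : linear (fun v : 'rV[R]_n => v 0 j).
Proof. by move=> a u v; rewrite !mxE. Qed.

Definition coord_lin n j : {linear 'rV[R]_n -> R} :=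
  HB.pack (fun v : 'rV[R]_n => v 0 j)
    (GRing.isLinear.Build _ _ _ _ _ (@coord_linear n j)).

Lemma scalel_linear W (w : W) : linear (fun a : R => a *: w).
Proof. by move=> a u v /=; rewrite scalerDl scalerA. Qed.

Definition scalel_lin W w : {linear R -> W} :=
  HB.pack (fun a : R => a *: w)
    (GRing.isLinear.Build _ _ _ _ _ (@scalel_linear W w)).

Lemma fst_lin_continuous V W : continuous (fst_lin V W).
Proof. by move=> x; exact: cvg_fst. Qed.

Lemma snd_lin_continuous V W : continuous (snd_lin V W).
Proof. by move=> x; exact: cvg_snd. Qed.

Lemma coord_lin_continuous n j : continuous (@coord_lin n j).
Proof. by move=> x; exact: coord_continuous. Qed.

Lemma scalel_lin_continuous W w : continuous (@scalel_lin W w).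
Proof. exact: scalel_continuous. Qed.

#[export] Instance fin_dim_R : fin_dim R.
Proof.
split; exists unit, (fun=> 1), (fun=> idfun); split=> [_ x|w]; first exact: cvg_id.
by rewrite big_const card_unit /= addr0 [_ *: _]mulr1.
Qed.

#[export] Instance fin_dim_rV n : fin_dim 'rV[R]_n.
Proof.
split; exists 'I_n, (fun j => delta_mx 0 j), (@coord_lin n).
by split=> [j|w]; [exact: coord_lin_continuous|exact: row_sum_delta].
Qed.

#[export] Instance fin_dim_prod V W : fin_dim V -> fin_dim W -> fin_dim (V * W)%type.
Proof.
move=> [[I [e [c [cc ce]]]]] [[J [e' [c' [cc' ce']]]]]; split.
exists (I + J)%type, (fun k => match k with inl i => (e i, 0) | inr j => (0, e' j) end).
exists (fun k => match k return {linear (V * W)%type -> R} with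
  inl i => GRing.Linear.clone _ _ _ _ (c i \o fst_lin V W) _
  | inr j => GRing.Linear.clone _ _ _ _ (c' j \o snd_lin V W) _ end).
split=> [[i|j] x|[v w]].
- by apply: continuous_comp; [exact: fst_lin_continuous|exact: cc].
- by apply: continuous_comp; [exact: snd_lin_continuous|exact: cc'].
rewrite big_sumType /= [RHS]surjective_pairing; congr (_, _).
  rewrite -[RHS]/(fst_lin V W _) linearD !linear_sum /= [X in _ + X]big1 ?addr0.
    exact: ce.
  by move=> j _; rewrite scaler0.
rewrite -[RHS]/(snd_lin V W _) linearD !linear_sum /= [X in X + _]big1 ?add0r.
  exact: ce'.
by move=> j _; rewrite scaler0.
Qed.

(* The second differential of a composite involves ['d G (F x)] applied to a
   moving vector; expanding it in a basis reduces the chain rule to products. *)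
Lemma Cn_compR V W k (U : set V) (U' : set W) (F : V -> W) (G : W -> R) :
  fin_dim W -> open U -> open U' -> (forall x, U x -> U' (F x)) ->
  Cn k U F -> Cn k U' G -> Cn k U (fun x => G (F x)).
Proof.
move=> [[I [e [c [cc ce]]]]] oU oU' FU; elim: k G => // k IH G Fk Gk.
have /CnS[F0 F1] := Fk; have /CnS[G0 G1] := Gk.
apply: (@CnS_diff _ _ _ _ _
  (fun x v => \sum_i c i ('d F x v) * 'd G (F x) (e i))) => // [x Ux|v].
  have dF := differentiableP (F0 _ Ux).
  have dG := differentiableP (G0 _ (FU _ Ux)).
  apply: is_diff_eq (is_diff_comp dF dG) _; apply/funext => v /=.
  rewrite [X in 'd G _ X]ce linear_sum; apply: eq_bigr => i _.
  by rewrite linearZ.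
apply: Cn_sum => // i; apply: CnM => //; first exact: Cn_linear.
by apply: (IH (fun y => 'd G y (e i))) => //; exact: CnW.
Qed.

Lemma Cn_coords V W k (U : set V) (F : V -> W) : open U -> fin_dim W ->
  (forall c : {linear W -> R}, continuous c -> Cn k U (fun x => c (F x))) ->
  Cn k U F.
Proof.
move=> oU [[I [e [c [cc ce]]]]] H; rewrite (_ : F = fun x => \sum_i c i (F x) *: e i).
  apply: Cn_sum => // i; apply: (@Cn_linear _ _ _ _ _ (scalel_lin (e i))) => //.
    exact: scalel_lin_continuous.
  exact: H.
by apply/funext => x; exact: ce.
Qed.

Lemma Cn_comp V W Z k (U : set V) (U' : set W) (F : V -> W) (G : W -> Z) :
  fin_dim W -> fin_dim Z -> open U -> open U' -> (forall x, U x -> U' (F x)) ->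
  Cn k U F -> Cn k U' G -> Cn k U (fun x => G (F x)).
Proof.
move=> fW fZ oU oU' FU Fk Gk; apply: Cn_coords => // c cc.
apply: (@Cn_compR _ _ _ _ U' F (fun y => c (G y))) => //.
exact: Cn_linear.
Qed.

Lemma CnZ V W k (U : set V) (F : V -> R) (G : V -> W) : fin_dim W -> open U ->
  Cn k U F -> Cn k U G -> Cn k U (fun x => F x *: G x).
Proof.
move=> fW oU Fk Gk; apply: Cn_coords => // c cc.
under eq_fun do rewrite linearZ /=.
by apply: CnM => //; exact: Cn_linear.
Qed.

Lemma Cn_pair V W Z k (U : set V) (F : V -> W) (G : V -> Z) : open U ->
  Cn k U F -> Cn k U G -> Cn k U (fun x => (F x, G x)).
Proof.
move=> oU; elim: k F G => // k IH F G /CnS[F0 F1] /CnS[G0 G1].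
apply: (@CnS_diff _ _ _ _ _ (fun x v => ('d F x v, 'd G x v))) => // [x Ux|v].
  have dF := differentiableP (F0 _ Ux); have dG := differentiableP (G0 _ Ux).
  exact: (is_diff_pair dF dG).
exact: IH.
Qed.

Lemma is_derive_diff (W : normedModType R) (f : R -> W) (x : R) (d : W) :
  is_derive x 1 f d -> is_diff x f (fun v => v *: d).
Proof.
move=> [df <-]; apply: DiffDef; first exact/derivable1_diffP.
by rewrite deriv1E // derive1E.
Qed.

(** On the line the differential at [x] is [v *: f' x]. Hence families of functions closed under
    differentiation are smooth by induction on the order. *)
Lemma Cn_deriv (W : normedModType R) k (U : set R) (f f' : R -> W) :
  fin_dim W -> open U ->
  (forall x, U x -> is_derive x 1 f (f' x)) -> Cn k U f' -> Cn k.+1 U f.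
Proof.
move=> fW oU df f'k.
apply: (@CnS_diff _ _ k U f (fun x v => v *: f' x)) => // [x Ux|v].
  by apply: is_derive_diff; exact: df.
by apply: CnZ => //; exact: Cn_cst.
Qed.
End Calculus.

Section SmoothOn.
Variable R : realType.
Implicit Types V W Z : normedModType R.

Lemma smooth_on_local V W (U : set V) (F : V -> W) :
  (forall x, U x -> exists2 U', U' x & smooth_on U' F) -> smooth_on U F.
Proof. by move=> H vs x /H[U' U'x]; apply. Qed.

Lemma sub_smooth_on V W (U U' : set V) (F : V -> W) :
  U `<=` U' -> smooth_on U' F -> smooth_on U F.
Proof. by move=> UU H vs x Ux; apply: H; exact: UU. Qed.

Lemma eq_smooth_on V W (U : set V) (F G : V -> W) : open U ->
  (forall x, U x -> F x = G x) -> smooth_on U F -> smooth_on U G.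
Proof.
move=> oU FG /smooth_onP sF; apply/smooth_onP => k.
exact: (eq_Cn oU FG).
Qed.

Lemma smooth_on_differentiable V W (U : set V) (F : V -> W) x :
  smooth_on U F -> U x -> differentiable F x.
Proof. by move=> sF; exact: (sF [::]). Qed.

Lemma smooth_on_diff V W (U : set V) (F : V -> W) v :
  smooth_on U F -> smooth_on U (fun x => 'd F x v).
Proof. by move=> sF vs; exact: (sF (v :: vs)). Qed.

Lemma smooth_on_continuous V W (U : set V) (F : V -> W) x :
  smooth_on U F -> U x -> {for x, continuous F}.
Proof.
by move=> sF Ux; exact/differentiable_continuous/(smooth_on_differentiable sF).
Qed.

Lemma smooth_continuous V W (F : V -> W) :
  smooth_on setT F -> continuous F.
Proof. by move=> sF x; exact: (smooth_on_continuous sF). Qed.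

Lemma smooth_on_cst V W (U : set V) (w : W) : open U -> smooth_on U (fun=> w).
Proof. by move=> oU; apply/smooth_onP => k; exact: Cn_cst. Qed.

Lemma smooth_on_id V (U : set V) : open U -> smooth_on U (fun x : V => x).
Proof. by move=> oU; apply/smooth_onP => k; exact: Cn_id. Qed.

Lemma smooth_onD V W (U : set V) (F G : V -> W) : open U ->
  smooth_on U F -> smooth_on U G -> smooth_on U (fun x => F x + G x).
Proof.
by move=> oU /smooth_onP ? /smooth_onP ?; apply/smooth_onP => k; exact: CnD.
Qed.

Lemma smooth_on_sum V W (U : set V) (I : Type) (r : seq I) (F : I -> V -> W) :
  open U -> (forall i, smooth_on U (F i)) ->
  smooth_on U (fun x => \sum_(i <- r) F i x).
Proof.
move=> oU H; apply/smooth_onP => k; apply: Cn_sum => // i.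
exact: ((smooth_onP _ _).1 (H i)).
Qed.

Lemma smooth_on_linear V W Z (U : set V) (L : {linear W -> Z}) (F : V -> W) :
  open U -> continuous L -> smooth_on U F -> smooth_on U (fun x => L (F x)).
Proof.
by move=> oU cL /smooth_onP ?; apply/smooth_onP => k; exact: Cn_linear.
Qed.

Lemma smooth_on_comp V W Z (U : set V) (U' : set W) (F : V -> W) (G : W -> Z) :
  fin_dim W -> fin_dim Z -> open U -> open U' -> (forall x, U x -> U' (F x)) ->
  smooth_on U F -> smooth_on U' G -> smooth_on U (fun x => G (F x)).
Proof.
move=> fW fZ oU oU' FU /smooth_onP ? /smooth_onP ?; apply/smooth_onP => k.
exact: (Cn_comp fW fZ oU oU' FU).
Qed.

Lemma smooth_onM V (U : set V) (F G : V -> R) : open U ->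
  smooth_on U F -> smooth_on U G -> smooth_on U (fun x => F x * G x).
Proof.
by move=> oU /smooth_onP ? /smooth_onP ?; apply/smooth_onP => k; exact: CnM.
Qed.

Lemma smooth_onZ V W (U : set V) (F : V -> R) (G : V -> W) : fin_dim W ->
  open U -> smooth_on U F -> smooth_on U G -> smooth_on U (fun x => F x *: G x).
Proof.
by move=> ? ? /smooth_onP ? /smooth_onP ?; apply/smooth_onP => k; exact: CnZ.
Qed.

Lemma smooth_on_pair V W Z (U : set V) (F : V -> W) (G : V -> Z) : open U ->
  smooth_on U F -> smooth_on U G -> smooth_on U (fun x => (F x, G x)).
Proof.
by move=> oU /smooth_onP ? /smooth_onP ?; apply/smooth_onP => k; exact: Cn_pair.
Qed.

Lemma smooth_onN V (U : set V) (F : V -> R) : open U ->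
  smooth_on U F -> smooth_on U (fun x => - F x).
Proof.
move=> oU sF; apply: (@eq_smooth_on _ _ _ (fun x => -1 * F x)) => //.
  by move=> x _; rewrite mulN1r.
by apply: smooth_onM => //; exact: smooth_on_cst.
Qed.

Lemma smooth_onB V (U : set V) (F G : V -> R) : open U ->
  smooth_on U F -> smooth_on U G -> smooth_on U (fun x => F x - G x).
Proof. by move=> oU sF sG; apply: smooth_onD => //; exact: smooth_onN. Qed.

Lemma smooth_on_coord V n (U : set V) (F : V -> 'rV[R]_n) j : open U ->
  smooth_on U F -> smooth_on U (fun x => F x 0 j).
Proof.
by move=> oU; exact: (smooth_on_linear (L := coord_lin R j) oU (@coord_lin_continuous R n j)).
Qed.

Lemma smooth_on_row V n (U : set V) (F : V -> 'I_n -> R) : open U ->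
  (forall j, smooth_on U (fun x => F x j)) ->
  smooth_on U (fun x => \row_j F x j).
Proof.
move=> oU H.
apply: (@eq_smooth_on _ _ _ (fun x => \sum_j F x j *: delta_mx 0 j)) => //.
  by move=> x _; rewrite [RHS]row_sum_delta; apply: eq_bigr => j _; rewrite mxE.
apply: smooth_on_sum => // j; apply: smooth_onZ => //.
exact: smooth_on_cst.
Qed.

Lemma smooth_on_deriv W (U : set R) (f f' : R -> W) : fin_dim W -> open U ->
  (forall x, U x -> is_derive x 1 f (f' x)) -> smooth_on U f' -> smooth_on U f.
Proof.
move=> fW oU df /smooth_onP f'k; apply/smooth_onP => -[//|k].
exact: (Cn_deriv fW oU df).
Qed.

End SmoothOn.

(** * Smoothness of elementary functions, and a smooth step *)

Section SpecialFunctions.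
Variable R : realType.

Lemma smooth_sin_cos :
  smooth_on [set: R] (@sin R) /\ smooth_on [set: R] (@cos R).
Proof.
(* The two orders grow together, each function being the derivative of the other up to sign. *)
suff H k : Cn k [set: R] (@sin R) /\ Cn k [set: R] (@cos R).
  by split; apply/smooth_onP => k; have [] := H k.
elim: k => [|k [IHs IHc]]; first by split; exact: Cn0.
have oT : open [set: R] by exact: openT.
split.
  by apply: (Cn_deriv (f' := @cos R)) => // x _; exact: is_derive_sin.
apply: (Cn_deriv (f' := fun x => - sin x)) => //.
have -> : (fun x => - sin x) = (fun x : R => -1 * sin x).
  by apply/funext => x; rewrite mulN1r.
by apply: CnM => //; exact: Cn_cst.
Qed.

Lemma is_derive_inv (x : R) : x != 0 -> is_derive x 1 (fun x => x^-1) (- x ^- 2).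
Proof.
move=> x0; have := is_deriveV x0 (is_derive_id x (1 : R)).
by rewrite [_ *: _]mulr1.
Qed.

Lemma smooth_inv : smooth_on [set x : R | x != 0] (fun x => x^-1).
Proof.
have oU : open [set x : R | x != 0].
  by apply: open_neq.
apply/smooth_onP; elim=> [|k IH]; first exact: Cn0.
apply: (Cn_deriv (f' := fun x => -1 * (x^-1 * x^-1))) => // [x x0|].
  apply: is_derive_eq (is_derive_inv x0) _.
  by rewrite mulN1r expr2 invfM.
by apply: CnM => //; [exact: Cn_cst|exact: CnM].
Qed.

Lemma smooth_onV (V : normedModType R) (U : set V) (F : V -> R) : open U ->
  (forall x, U x -> F x != 0) -> smooth_on U F -> smooth_on U (fun x => (F x)^-1).
Proof.
move=> oU F0 sF.
apply: (@smooth_on_comp R V R R U [set x | x != 0] F (fun x => x^-1)) => //.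
exact: smooth_inv.
Qed.

Lemma smooth_atan : smooth_on [set: R] (@atan R).
Proof.
have oT : open [set: R] by exact: openT.
apply: (smooth_on_deriv (f' := fun x => (1 + x ^+ 2)^-1)) => //.
apply: smooth_onV => //.
  by move=> x _; rewrite gt_eqF // ltr_wpDr // ?sqr_ge0.
apply: smooth_onD => //; first exact: smooth_on_cst.
by apply: smooth_onM => //; exact: smooth_on_id.
Qed.

(* The derivative of [flat n] is [flat n.+2 - n *: flat n.+1], so the whole
   family is smooth by simultaneous induction on the order. *)
Definition flat (n : nat) (x : R) : R :=
  if 0 < x then x^-1 ^+ n * expR (- x^-1) else 0.

(** With y = 1/x, the exponential series gives e^y >= y^(n+2) / (n+2)!, hence y^n e^(-y) <= (n+2)!
    y^(-2). The spare factor x^2 is what makes the derivative at 0 vanish. *)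
Lemma flat_le n (x : R) : `|flat n x| <= (n.+2)`!%:R * x ^+ 2.
Proof.
rewrite /flat; case: ifPn => x0; last by rewrite normr0 mulr_ge0 ?sqr_ge0.
have y0 : 0 < x^-1 by rewrite invr_gt0.
rewrite ger0_norm ?mulr_ge0 ?expR_ge0 ?exprn_ge0 ?(ltW y0) //.
rewrite expRN ler_pdivrMr ?expR_gt0 //.
have /(le_trans _) := expR_ge1Dxn n.+1 (ltW y0); move=> /(_ (x^-1 ^+ n.+2 / n.+2`!%:R)).
rewrite lerDr ler01 => /(_ isT) H.
apply: (@le_trans _ _ (n.+2`!%:R * x ^+ 2 * (x^-1 ^+ n.+2 / n.+2`!%:R))); last first.
  by rewrite ler_wpM2l // mulr_ge0 ?sqr_ge0.
rewrite le_eqVlt; apply/orP; left; apply/eqP.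
rewrite -addn2 exprD exprVn; field.
by rewrite pnatr_eq0 -lt0n fact_gt0 expf_neq0 ?(lt0r_neq0 x0).
Qed.

Lemma is_derive_flat n (x : R) :
  is_derive x 1 (flat n) (flat n.+2 x - n%:R * flat n.+1 x).
Proof.
have [x0|x0|->] := ltgtP x 0.
- rewrite /flat !ltNge ltW //= mulr0 subr0.
  apply: (@near_eq_is_derive _ _ _ (fun=> 0)).
  by near=> y; rewrite ltNge ltW //; near: y; exact: lt_nbhsl.
- have xn0 : x != 0 by rewrite gt_eqF.
  have dV : is_derive x 1 (fun x : R => x^-1) (- x ^- 2).
    exact: is_derive_inv.
  have dVn : is_derive x 1 (fun x : R => x^-1 ^+ n) (n%:R * x^-1 ^+ n.-1 * (- x ^- 2)).
    have := is_deriveX n dV; rewrite /GRing.scale /= => H.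
    by rewrite exprfctE in H; apply: is_derive_eq H _; rewrite ?mulr_natl.
  have dE : is_derive x 1 (fun x : R => expR (- x^-1)) (expR (- x^-1) * (x ^- 2)).
    have dN : is_derive x 1 (fun x : R => - x^-1) (x ^- 2).
      by have := is_deriveN dV; rewrite opprK.
    exact: (@is_derive1_comp _ expR (fun x => - x^-1)).
  have fE : \forall y \near x, y^-1 ^+ n * expR (- y^-1) = flat n y.
    by near=> y; rewrite /flat ifT //; near: y; exact: lt_nbhsr.
  apply: (near_eq_is_derive fE); apply: is_derive_eq (is_deriveM dVn dE) _.
  rewrite /flat x0 /GRing.scale /=.
  rewrite -exprVn; move: (x^-1) (expR _) => y z.
  by case: n {dVn fE} => [|n] /=; rewrite ?expr0 ?exprS; ring.
rewrite /flat ltxx mulr0 subr0 -/(flat n).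
(* By [flat_le] the difference quotient at 0 is at most (n+2)! |h|. *)
have lim0 : h^-1 *: (flat n (h *: 1 + 0) - flat n 0) @[h --> 0^'] --> (0 : R).
  apply/cvgrPdist_le => e e0.
  have C0 : 0 < (n.+2)`!%:R :> R by rewrite ltr0n fact_gt0.
  near=> h.
  have h0 : h != 0 by near: h; exact: nbhs_dnbhs_neq.
  rewrite sub0r normrN addr0 [h *: 1]mulr1 {2}/flat ltxx subr0 normrZ normfV.
  rewrite ler_pdivrMl ?normr_gt0 // (le_trans (flat_le n h)) //.
  rewrite -(real_normK (num_real h)) expr2 mulrCA ler_wpM2l //.
  rewrite -ler_pdivlMl // mulrC.
  near: h; apply: dnbhs0_le; exact: divr_gt0.
apply: DeriveDef; last exact: cvg_lim lim0.
by apply/cvg_ex; exists 0.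
Unshelve. all: by end_near. Qed.

Lemma smooth_flat n : smooth_on [set: R] (flat n).
Proof.
have oT : open [set: R] by exact: openT.
apply/smooth_onP => k; elim: k n => [|k IH] n; first exact: Cn0.
apply: (Cn_deriv (f' := fun x => flat n.+2 x + - n%:R * flat n.+1 x)) => //.
  by move=> x _; rewrite mulNr; exact: is_derive_flat.
by apply: CnD => //; apply: CnM => //; exact: Cn_cst.
Qed.

(** The usual quotient built from e^(-1/x). It rises from 0 to 1 on [1/4, 1/2]; it will be evaluated
    at a squared radius. *)
Definition step (x : R) : R :=
  flat 0 (4 * x - 1) / (flat 0 (4 * x - 1) + flat 0 (2 - 4 * x)).

Lemma flat_ge0 x : 0 <= flat 0 x.
Proof. by rewrite /flat; case: ifP; rewrite ?mul1r ?expR_ge0. Qed.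

Lemma flat_gt0 x : 0 < x -> 0 < flat 0 x.
Proof. by move=> x0; rewrite /flat x0 mul1r expR_gt0. Qed.

Lemma flat_eq0 n x : x <= 0 -> flat n x = 0.
Proof. by move=> x0; rewrite /flat ltNge x0. Qed.

(** The arguments 4x - 1 and 2 - 4x add up to 1, so one of them is positive. *)
Lemma step_den_gt0 x : 0 < flat 0 (4 * x - 1) + flat 0 (2 - 4 * x).
Proof.
have [x1|x1] := ltP (1 / 4) x.
  by rewrite ltr_pwDl ?flat_ge0 // flat_gt0 //; lra.
by rewrite ltr_wpDl ?flat_ge0 // flat_gt0 //; lra.
Qed.

Lemma step_eq0 x : x <= 1 / 4 -> step x = 0.
Proof. by move=> x1; rewrite /step flat_eq0 ?mul0r //; lra. Qed.

Lemma step_eq1 x : 1 / 2 <= x -> step x = 1.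
Proof.
move=> x1; have := step_den_gt0 x; rewrite /step [flat 0 (2 - _)]flat_eq0; last lra.
by rewrite addr0 => /lt0r_neq0; exact: divff.
Qed.

Lemma step_ge0 x : 0 <= step x.
Proof. by rewrite /step divr_ge0 ?flat_ge0 // ltW // step_den_gt0. Qed.

Lemma step_le1 x : step x <= 1.
Proof.
by rewrite /step ler_pdivrMr ?step_den_gt0 // mul1r lerDl flat_ge0.
Qed.

Lemma smooth_step : smooth_on [set: R] step.
Proof.
have oT : open [set: R] by exact: openT.
have sl a b : smooth_on [set: R] (fun x => flat 0 (a * x + b)).
  apply: (@smooth_on_comp R R R R setT setT (fun x => a * x + b) (flat 0)) => //.
    apply: smooth_onD => //; last exact: smooth_on_cst.
    by apply: smooth_onM => //; [exact: smooth_on_cst|exact: smooth_on_id].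
  exact: smooth_flat.
have s2 : smooth_on [set: R] (fun x => flat 0 (2 - 4 * x)).
  apply: eq_smooth_on (sl (- 4) 2) => // x _; congr flat; ring.
apply: smooth_onM => //.
apply: smooth_onV => //; last exact: smooth_onD (sl 4 (-1)) s2.
by move=> x _; rewrite gt_eqF // step_den_gt0.
Qed.

End SpecialFunctions.

(** * Local extensions and the diffeomorphism groups *)

Section LocalExtensions.
Variable R : realType.
Implicit Types V W Z : normedModType R.

Lemma set_valE (T : Type) (A : set T) p : A p -> exists x : A, set_val x = p.
Proof. by move=> Ap; exists (SigSub (mem_set Ap)). Qed.

Lemma local_extension_differentiable V W (T : Type) (i : T -> V) (f : T -> W) x F :
  local_extension i f x F -> differentiable F (i x).
Proof. by case=> U [_ Ux sF _]; exact: smooth_on_differentiable Ux. Qed.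

Lemma local_extension_val V W (T : Type) (i : T -> V) (f : T -> W) x F :
  local_extension i f x F -> F (i x) = f x.
Proof. by case=> U [_ Ux _]; exact. Qed.

Lemma local_extension_near V W (T : Type) (i : T -> V) (f : T -> W) x F :
  local_extension i f x F -> \forall p \near i x, forall y, i y = p -> F p = f y.
Proof.
case=> U [oU Ux _ FU]; have : nbhs (i x) U by exact: open_nbhs_nbhs.
by apply: filterS => p Up y yp; rewrite -yp FU // yp.
Qed.

Lemma smooth_global V W (T : Type) (i : T -> V) (f : T -> W) F x :
  smooth_on setT F -> (forall y, F (i y) = f y) -> local_extension i f x F.
Proof. by move=> sF Ff; exists setT; split=> //; exact: openT. Qed.

Lemma open_preimage_smooth V W (U : set V) (U' : set W) (F : V -> W) :
  open U -> open U' -> smooth_on U F -> open (U `&` F @^-1` U').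
Proof.
move=> oU oU' sF; rewrite openE => x [Ux U'Fx].
apply: filterI; first exact: open_nbhs_nbhs.
by apply: (smooth_on_continuous sF Ux); exact: open_nbhs_nbhs.
Qed.

Lemma local_extension_comp V W Z (S T : Type) (i : S -> V) (j : T -> W)
  (k : S -> T) (f : T -> Z) s K F : fin_dim W -> fin_dim Z ->
  local_extension i (fun x => j (k x)) s K -> local_extension j f (k s) F ->
  local_extension i (fun x => f (k x)) s (fun p => F (K p)).
Proof.
move=> fW fZ extK [U' [oU' Us' sF Ff]].
have Ks := local_extension_val extK; case: extK => U [oU Us sK Kk].
have oI := open_preimage_smooth oU oU' sK.
exists (U `&` K @^-1` U'); split=> //; first by split=> //=; rewrite Ks.
  apply: (smooth_on_comp (U' := U') (F := K)) => //; first by move=> x [].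
  by apply: sub_smooth_on sK => x [].
move=> y [Uy /= U'y]; rewrite Kk // Ff //; first by rewrite -Kk.
Qed.

Lemma smooth_comp V W Z (S T : Type) (i : S -> V) (j : T -> W)
  (k : S -> T) (f : T -> Z) : fin_dim W -> fin_dim Z ->
  smooth i (fun x => j (k x)) -> smooth j f -> smooth i (fun x => f (k x)).
Proof.
move=> fW fZ sk sf x; have [K extK] := sk x; have [F extF] := sf (k x).
by exists (fun p => F (K p)); exact: local_extension_comp extF.
Qed.

(** A directional derivative is already determined by its one-sided limit. One side is all there is
    at a boundary point of the disc, where only inward segments stay inside. *)
Lemma diff_eq_along V W (F G : V -> W) p v :
  differentiable F p -> differentiable G p -> F p = G p ->
  (\forall h \near 0^'+, F (h *: v + p) = G (h *: v + p)) ->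
  'd F p v = 'd G p v.
Proof.
move=> dF dG FGp FG; rewrite -!deriveE //.
have cF : h^-1 *: (F (h *: v + p) - F p) @[h --> 0^'+] --> 'D_v F p.
  by apply: cvg_dnbhs_at_right; exact: diff_derivable.
have cG : h^-1 *: (G (h *: v + p) - G p) @[h --> 0^'+] --> 'D_v G p.
  by apply: cvg_dnbhs_at_right; exact: diff_derivable.
rewrite -(cvg_lim (@norm_hausdorff _ _) cF); apply: cvg_lim => //.
apply: cvg_trans cG; apply: near_eq_cvg.
by apply: filterS FG => h ->; rewrite FGp.
Qed.

Lemma near_line V (U : set V) (p v : V) : nbhs p U ->
  \forall h \near (0 : R)^'+, U (h *: v + p).
Proof.
move=> Up; have c : (fun h : R => h *: v + p) @ (0 : R)^'+ --> p.
  apply: cvg_at_right_filter; rewrite -[X in _ --> X]add0r -(scale0r v).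
  by apply: cvgD; [exact: scalel_continuous|exact: cvg_cst].
exact: c _ Up.
Qed.

End LocalExtensions.

(** * The differential of a map on the closed disc *)

Section Disc.
Variable R : realType.
Notation plane := 'rV[R]_2.

Definition sqn (p : plane) : R := p 0 0 ^+ 2 + p 0 1 ^+ 2.

Lemma ord2P (j : 'I_2) : j = 0 \/ j = 1.
Proof. by case: j => [[|[|//]] H]; [left|right]; exact: val_inj. Qed.

Lemma cdiscE (p : plane) : cdisc R p = (sqn p <= 1). Proof. by []. Qed.

Lemma circleE (p : plane) : circle R p = (sqn p = 1). Proof. by []. Qed.

Lemma circle_disc (p : plane) : circle R p -> cdisc R p.
Proof. by rewrite circleE cdiscE => ->. Qed.

Lemma cdisc_convex (p q : plane) h : 0 <= h <= 1 -> cdisc R p -> cdisc R q ->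
  cdisc R (h *: (q - p) + p).
Proof.
rewrite !cdiscE /sqn !mxE; move: (p 0 0) (p 0 1) (q 0 0) (q 0 1) => a b c d.
move=> /andP[h0 h1] pd qd.
(* The squared norm of a convex combination is the same combination of the squared norms, minus h (1
   - h) |q - p|^2. *)
rewrite (_ : _ + _ = (1 - h) * (a ^+ 2 + b ^+ 2) + h * (c ^+ 2 + d ^+ 2)
  - h * (1 - h) * ((c - a) ^+ 2 + (d - b) ^+ 2)); last by ring.
have H : 0 <= h * (1 - h) * ((c - a) ^+ 2 + (d - b) ^+ 2).
  by apply: mulr_ge0; [apply: mulr_ge0; rewrite ?subr_ge0|apply: addr_ge0; exact: sqr_ge0].
have H1 : 0 <= (1 - h) * (1 - (a ^+ 2 + b ^+ 2)) by rewrite mulr_ge0 ?subr_ge0.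
have H2 : 0 <= h * (1 - (c ^+ 2 + d ^+ 2)) by rewrite mulr_ge0 ?subr_ge0.
lra.
Qed.

(** For [q] in the disc the segment from [p] to [q] stays in the disc, so both differentials agree
    on [q - p]. Subtracting the case [q = 0] yields agreement on [q], and the disc contains a basis.
    An orientation condition can thus be checked on a single extension. *)
Lemma disc_ext_diff (W : normedModType R) (f : cdisc R -> W) x F G :
  local_extension set_val f x F -> local_extension set_val f x G ->
  'd F (set_val x) = 'd G (set_val x) :> (plane -> W).
Proof.
move=> extF extG; set p := set_val x.
have dF := local_extension_differentiable extF.
have dG := local_extension_differentiable extG.
have along (q : plane) : cdisc R q -> 'd F p (q - p) = 'd G p (q - p).
  move=> qd; apply: diff_eq_along => //.
    by rewrite (local_extension_val extF) (local_extension_val extG).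
  have nF := near_line (q - p) (local_extension_near extF).
  have nG := near_line (q - p) (local_extension_near extG).
  have n0 := nbhs_right_ge (0 : R); have n1 := nbhs_right_le (@ltr01 R).
  apply: filterS2 (filterI nF nG) (filterI n0 n1) => h /= [hF hG] [h0 h1].
  have [|y yE] := @set_valE _ (cdisc R) (h *: (q - p) + p).
    by apply: cdisc_convex => //; [rewrite h0|exact: set_valP].
  by rewrite (hF _ yE) (hG _ yE).
have at_disc (q : plane) : cdisc R q -> 'd F p q = 'd G p q.
  move=> qd; have cd0 : cdisc R 0 by rewrite cdiscE /sqn !mxE expr0n addr0.
  have := along _ qd; have := along _ cd0.
  by rewrite sub0r !linearN !linearB /= => /oppr_inj -> /addIr.
apply/funext => v; rewrite (row_sum_delta v) !linear_sum /=.
apply: eq_bigr => j _; rewrite !linearZ /= at_disc // cdiscE /sqn !mxE /=.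
by have [->|->] := ord2P j; rewrite /= expr1n expr0n /= ?addr0 ?add0r.
Qed.

End Disc.

Section Curves.
Variable R : realType.
Implicit Types V W : normedModType R.

Lemma is_diff_derive V W (f D : V -> W) x v : is_diff x f D -> is_derive x v f (D v).
Proof.
move=> [df <-]; apply: DeriveDef; first exact: diff_derivable.
by rewrite deriveE.
Qed.

Lemma is_derive_comp V W (f : R -> V) (G : V -> W) (x : R) d :
  is_derive x 1 f d -> differentiable G (f x) ->
  is_derive x 1 (fun t => G (f t)) ('d G (f x) d).
Proof.
move=> /is_derive_diff df /differentiableP dG.
have := is_diff_derive (1 : R) (is_diff_comp df dG).
by rewrite /= scale1r.
Qed.

Lemma is_derive_linear V W (L : {linear V -> W}) (f : R -> V) (x : R) d :
  continuous L -> is_derive x 1 f d -> is_derive x 1 (fun t => L (f t)) (L d).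
Proof.
move=> cL df; have dL : differentiable L (f x) by exact: linear_differentiable.
by have := is_derive_comp df dL; rewrite diff_lin.
Qed.

Lemma is_derive_coord n (f : R -> 'rV[R]_n) (x : R) d j :
  is_derive x 1 f d -> is_derive x 1 (fun t => f t 0 j) (d 0 j).
Proof.
exact: (is_derive_linear (L := coord_lin R j) (@coord_lin_continuous R n j)).
Qed.

Lemma is_derive_scalel W (k : R -> R) (w : W) (x dk : R) :
  is_derive x 1 k dk -> is_derive x 1 (fun t => k t *: w) (dk *: w).
Proof.
exact: (is_derive_linear (L := scalel_lin w) (@scalel_lin_continuous R W w)).
Qed.

End Curves.

(** * Rotations and tangent vectors of the circle *)

Section Rotation.
Variable R : realType.
Notation plane := 'rV[R]_2.

Lemma rotE (z : plane) : (rot z 0 0 = - z 0 1) * (rot z 0 1 = z 0 0).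
Proof. by rewrite /rot !mxE. Qed.

Lemma dotpE (u v : plane) : dotp u v = u 0 0 * v 0 0 + u 0 1 * v 0 1.
Proof. by rewrite /dotp big_ord_recl big_ord1; congr (_ + u 0 _ * v 0 _); exact: val_inj. Qed.

Lemma plane_eq (u v : plane) : u 0 0 = v 0 0 -> u 0 1 = v 0 1 -> u = v.
Proof. by move=> H0 H1; apply/rowP => j; have [->|->] := ord2P j. Qed.

(* [turn t z] is e^(it) z. *)
Definition turn (t : R) (z : plane) : plane := cos t *: z + sin t *: rot z.

Lemma turnE t (z : plane) : (turn t z 0 0 = cos t * z 0 0 - sin t * z 0 1) *
  (turn t z 0 1 = cos t * z 0 1 + sin t * z 0 0).
Proof. by rewrite /turn !mxE /= mulrN. Qed.

Lemma turn0 z : turn 0 z = z.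
Proof. by rewrite /turn cos0 sin0 scale1r scale0r addr0. Qed.

Lemma turnD s t z : turn (s + t) z = turn s (turn t z).
Proof. by apply: plane_eq; rewrite !turnE cosD sinD; ring. Qed.

Lemma turnZ t r z : turn t (r *: z) = r *: turn t z.
Proof. by apply: plane_eq; rewrite !(turnE, mxE); ring. Qed.

Lemma turn_rot t z : turn t (rot z) = rot (turn t z).
Proof. by apply: plane_eq; rewrite !(turnE, rotE); ring. Qed.

Lemma sqn_turn t z : sqn (turn t z) = sqn z.
Proof.
rewrite /sqn !turnE; move: (z 0 0) (z 0 1) => a b.
have H := cos2Dsin2 t; rewrite -[RHS]mul1r -H; ring.
Qed.

Lemma is_derive_turn (t : R) z : is_derive t 1 (turn^~ z) (rot (turn t z)).
Proof.
have dc := is_derive_scalel z (is_derive_cos t).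
have ds := is_derive_scalel (rot z) (is_derive_sin t).
apply: is_derive_eq (is_deriveD dc ds) _.
by apply: plane_eq; rewrite !(turnE, rotE, mxE); ring.
Qed.

Lemma turn_cvg0 z : turn t z @[t --> (0 : R)] --> z.
Proof.
have : {for 0, continuous (turn^~ z)}.
  apply/differentiable_continuous/derivable1_diffP.
  by case: (is_derive_turn 0 z).
by rewrite /prop_for /continuous_at /= turn0.
Qed.

Lemma sqnZ r (p : plane) : sqn (r *: p) = r ^+ 2 * sqn p.
Proof. by rewrite /sqn !mxE; ring. Qed.

Lemma sqn_gt0 (p : plane) : p != 0 -> 0 < sqn p.
Proof.
apply: contra_neqT; rewrite -leNgt /sqn => H.
have [/eqP p0 /eqP p1] : p 0 0 ^+ 2 == 0 /\ p 0 1 ^+ 2 == 0.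
  by apply/andP; rewrite -paddr_eq0 ?sqr_ge0 // eq_le H addr_ge0 ?sqr_ge0.
by apply: plane_eq; rewrite mxE; apply/eqP; rewrite -sqrf_eq0; apply/eqP.
Qed.

Lemma sqn_ge0 (p : plane) : 0 <= sqn p.
Proof. by rewrite addr_ge0 ?sqr_ge0. Qed.

Lemma is_derive_sqn (f : R -> plane) (x : R) d : is_derive x 1 f d ->
  is_derive x 1 (fun t => sqn (f t)) (2 * dotp d (f x)).
Proof.
move=> df; have d0 := is_derive_coord 0 df; have d1 := is_derive_coord 1 df.
apply: is_derive_eq (is_deriveD (is_deriveM d0 d0) (is_deriveM d1 d1)) _.
by rewrite dotpE /GRing.scale /=; ring.
Qed.

(** For a unit vector [q], the pair [q], [rot q] is an orthonormal basis, and [w] has no component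
    along [q]. *)
Lemma orthogonal_rot (w q : plane) : sqn q = 1 -> dotp w q = 0 ->
  w = dotp w (rot q) *: rot q.
Proof.
rewrite !dotpE !rotE /sqn => q1 wq.
apply: plane_eq; rewrite [RHS]mxE rotE;
  move: (w 0 0) (w 0 1) (q 0 0) (q 0 1) q1 wq => a b c d q1 wq.
  transitivity (a * (c ^+ 2 + d ^+ 2) - c * (a * c + b * d)); last by ring.
  by rewrite q1 wq; ring.
transitivity (b * (c ^+ 2 + d ^+ 2) - d * (a * c + b * d)); last by ring.
by rewrite q1 wq; ring.
Qed.

Lemma rot_dot (q : plane) : dotp (rot q) (rot q) = sqn q.
Proof. by rewrite dotpE !rotE /sqn; ring. Qed.

(** The tangent vector [rot z] is the velocity at time 0 of the curve [turn t z], which stays on the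
    circle; along it both extensions equal [f]. *)
Lemma circle_ext_diff (W : normedModType R) (f : circle R -> W) z F G :
  local_extension set_val f z F -> local_extension set_val f z G ->
  'd F (set_val z) (rot (set_val z)) = 'd G (set_val z) (rot (set_val z)).
Proof.
move=> extF extG; set p := set_val z.
have dp := is_derive_turn 0 p; rewrite turn0 in dp.
have dF : differentiable F (turn 0 p).
  by rewrite turn0; exact: local_extension_differentiable extF.
have dG : differentiable G (turn 0 p).
  by rewrite turn0; exact: local_extension_differentiable extG.
have := is_derive_comp dp dF; rewrite turn0 => -[_ <-].
have := is_derive_comp dp dG; rewrite turn0 => -[_ <-].
apply: near_eq_derive.
have ct := @turn_cvg0 p.
have nF : \forall t \near (0 : R), forall y, set_val y = turn t p ->
  F (turn t p) = f y := ct _ (local_extension_near extF).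
have nG : \forall t \near (0 : R), forall y, set_val y = turn t p ->
  G (turn t p) = f y := ct _ (local_extension_near extG).
apply: filterS2 nF nG => t hF hG.
have [|y yE] := @set_valE _ (circle R) (turn t p).
  by rewrite circleE sqn_turn -circleE; exact: set_valP.
by rewrite (hF _ yE) (hG _ yE).
Qed.

(** Along the circle the squared norm of [K] is constantly 1. Differentiating it shows that the
    image of the tangent vector is orthogonal to [k z], hence a multiple of [rot (k z)]. *)
Lemma circle_tangent (k : circle R -> circle R) z K :
  local_extension set_val (fun y => set_val (k y)) z K ->
  'd K (set_val z) (rot (set_val z)) =
  dotp ('d K (set_val z) (rot (set_val z))) (rot (set_val (k z)))
    *: rot (set_val (k z)).
Proof.
move=> extK; set p := set_val z; apply: orthogonal_rot; first exact: (set_valP (k z)).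
have dp := is_derive_turn 0 p; rewrite turn0 in dp.
have dK : differentiable K (turn 0 p).
  by rewrite turn0; exact: local_extension_differentiable extK.
have := is_derive_sqn (is_derive_comp dp dK); rewrite turn0.
rewrite (local_extension_val extK) => -[_ H].
suff : 2 * dotp ('d K p (rot p)) (set_val (k z)) = 0.
  by move/eqP; rewrite mulf_eq0 pnatr_eq0 => /eqP.
rewrite -H; transitivity ('D_1 (cst 1 : R -> R) (0 : R)); last by rewrite derive_cst.
apply: near_eq_derive.
have ct := @turn_cvg0 p.
have nK : \forall t \near (0 : R), forall y, set_val y = turn t p ->
  K (turn t p) = set_val (k y) := ct _ (local_extension_near extK).
apply: filterS nK => t hK.
have [|y yE] := @set_valE _ (circle R) (turn t p).
  by rewrite circleE sqn_turn -circleE; exact: set_valP.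
by rewrite (hK _ yE); exact: (set_valP (k y)).
Qed.

End Rotation.

Section Jacobian.
Variable K : numFieldType.

Lemma jacobianE m n (F : 'rV[K]_m -> 'rV[K]_n) p v : v *m jacobian F p = 'd F p v.
Proof. exact: mul_rV_lin1. Qed.

(** Vectors are rows and act from the left, so the factors appear in the order in which the maps are
    applied. *)
Lemma jacobian_comp m n q (F : 'rV[K]_m -> 'rV[K]_n) (G : 'rV[K]_n -> 'rV[K]_q) p :
  differentiable F p -> differentiable G (F p) ->
  jacobian (fun x => G (F x)) p = jacobian F p *m jacobian G (F p).
Proof.
move=> dF dG; apply/row_matrixP => i; have dc := diff_comp dF dG.
rewrite !rowE mulmxA !jacobianE; exact: (congr1 (@^~ _) dc).
Qed.

Lemma jacobian_id n (p : 'rV[K]_n) : jacobian id p = 1%:M.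
Proof.
apply/row_matrixP => i; rewrite !rowE mulmx1 jacobianE.
by have [_ ->] := is_diff_id p.
Qed.

Lemma eq_jacobian m n (F G : 'rV[K]_m -> 'rV[K]_n) p :
  'd F p = 'd G p :> (_ -> _) -> jacobian F p = jacobian G p.
Proof.
move=> E; apply/row_matrixP => i.
have rE (H : 'rV[K]_m -> 'rV[K]_n) : row i (jacobian H p) = 'd H p (delta_mx 0 i).
  by rewrite rowE jacobianE.
apply: etrans (rE F) _; apply: etrans _ (esym (rE G)).
exact: (congr1 (fun D : _ -> _ => D (delta_mx 0 i)) E).
Qed.

End Jacobian.

(** * Closure of the diffeomorphism groups under the group operations *)

Section Groups.

Lemma subgroupP (G : groupType) (K : set G) : K 1%g ->
  (forall x y, K x -> K y -> K (x * y)%g) -> (forall x, K x -> K x^-1%g) ->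
  subgroup K.
Proof.
move=> K1 KM KV; split; first exact/mem_set.
by move=> x y /set_mem Kx /set_mem Ky; apply/mem_set; exact/KM/KV.
Qed.

Variable R : realType.
Notation plane := 'rV[R]_2.

Lemma diffeo1 (A : set plane) : diffeo (1%g : sym A).
Proof.
have s1 : smooth set_val (fun x : A => set_val x).
  move=> x; exists id; apply: smooth_global => //.
  by apply: smooth_on_id; exact: openT.
by split.
Qed.

Lemma diffeoM (A : set plane) (g h : sym A) :
  diffeo g -> diffeo h -> diffeo (g * h)%g.
Proof.
move=> [sg sg'] [sh sh']; split; first exact: smooth_comp sh sg.
exact: smooth_comp sg' sh'.
Qed.

Lemma diffeoV (A : set plane) (g : sym A) : diffeo g -> diffeo g^-1%g.
Proof. by case. Qed.

Lemma disc_ext_jacobian (f : cdisc R -> plane) x F G :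
  local_extension set_val f x F -> local_extension set_val f x G ->
  jacobian F (set_val x) = jacobian G (set_val x).
Proof. by move=> eF eG; exact/eq_jacobian/(disc_ext_diff eF eG). Qed.

Lemma Diffp_disc_intro (g : sym (cdisc R)) : diffeo g ->
  (forall x, exists2 F, local_extension set_val (fun y => set_val (g y)) x F &
    0 < \det (jacobian F (set_val x))) -> Diffp_disc g.
Proof.
move=> dg H; split=> // x F eF; have [G eG] := H x.
by rewrite (disc_ext_jacobian eF eG).
Qed.

Lemma Diffp_disc1 : Diffp_disc (1%g : sym (cdisc R)).
Proof.
apply: Diffp_disc_intro => [|x]; first exact: diffeo1.
exists id; last by rewrite jacobian_id det1.
by apply: smooth_global => //; apply: smooth_on_id; exact: openT.
Qed.

Lemma Diffp_discM (g h : sym (cdisc R)) :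
  Diffp_disc g -> Diffp_disc h -> Diffp_disc (g * h)%g.
Proof.
move=> [dg pg] [dh ph]; apply: Diffp_disc_intro => [|x]; first exact: diffeoM.
have [K eK] := dh.1 x; have [F eF] := dg.1 (h x).
exists (fun p => F (K p)); first exact: local_extension_comp eK eF.
have dF : differentiable F (K (set_val x)).
  by rewrite (local_extension_val eK); exact: local_extension_differentiable eF.
rewrite (jacobian_comp (local_extension_differentiable eK) dF) det_mulmx.
rewrite mulr_gt0 ?(local_extension_val eK) //; first exact: ph eK.
exact: pg eF.
Qed.

(** If [F] extends the inverse near [x] and [K] extends [g] near the preimage of [x], then [K] after
    [F] extends the identity. The product of the two determinants is 1, so they have the same
    sign. *)
Lemma Diffp_discV (g : sym (cdisc R)) : Diffp_disc g -> Diffp_disc g^-1%g.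
Proof.
move=> [dg pg]; split=> [|x F eF]; first exact: diffeoV.
have [K eK] := dg.1 (g^-1%g x).
have gx : g (g^-1%g x) = x by exact: sym_invK.
have eKF := local_extension_comp (j := set_val) (f := fun y => set_val (g y))
  (fin_dim_rV R 2) (fin_dim_rV R 2) eF eK.
have e1 : local_extension set_val (fun y => set_val (g (g^-1%g y))) x (id : plane -> plane).
  apply: smooth_global; first by apply: smooth_on_id; exact: openT.
  by move=> y; congr set_val; rewrite [RHS]sym_invK.
have dK : differentiable K (F (set_val x)).
  by rewrite (local_extension_val eF); exact: local_extension_differentiable eK.
have := disc_ext_jacobian eKF e1.
rewrite jacobian_id (jacobian_comp (local_extension_differentiable eF) dK).
move/(congr1 determinant); rewrite det_mulmx det1 => d1.
have := pg _ _ eK; rewrite (local_extension_val eF) in d1.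
by move=> pK; rewrite -(pmulr_lgt0 _ pK) d1.
Qed.

Lemma Diffp_circle_intro (g : sym (circle R)) : diffeo g ->
  (forall z, exists2 F, local_extension set_val (fun y => set_val (g y)) z F &
    0 < dotp ('d F (set_val z) (rot (set_val z))) (rot (set_val (g z)))) ->
  Diffp_circle R g.
Proof.
move=> dg H; split=> // z F eF; have [G eG pG] := H z.
by rewrite (circle_ext_diff eF eG); exact: pG.
Qed.

Lemma dotpZl a (u v : plane) : dotp (a *: u) v = a * dotp u v.
Proof. by rewrite !dotpE !mxE; ring. Qed.

Lemma dotp_linear (L : {linear plane -> plane}) (w q u : plane) :
  w = dotp w q *: q -> dotp (L w) u = dotp w q * dotp (L q) u.
Proof. by move=> wE; rewrite {1}wE linearZ dotpZl. Qed.

(** Chain rule for angular speeds: by [circle_tangent] the velocity of [h] is its speed times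
    [rot (h z)], and the linear map ['d F] lets this scalar out. *)
Lemma circle_speed_comp (g h : circle R -> circle R) z K F :
  local_extension set_val (fun y => set_val (h y)) z K ->
  local_extension set_val (fun y => set_val (g y)) (h z) F ->
  dotp ('d (fun p => F (K p)) (set_val z) (rot (set_val z)))
    (rot (set_val (g (h z)))) =
  dotp ('d K (set_val z) (rot (set_val z))) (rot (set_val (h z))) *
  dotp ('d F (set_val (h z)) (rot (set_val (h z)))) (rot (set_val (g (h z)))).
Proof.
move=> eK eF.
have dF := local_extension_differentiable eF.
have dc : 'd (fun p => F (K p)) (set_val z) (rot (set_val z)) =
    'd F (set_val (h z)) ('d K (set_val z) (rot (set_val z))).
  rewrite -(local_extension_val eK) in dF *.
  have dc := diff_comp (local_extension_differentiable eK) dF.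
  exact: (congr1 (fun D : _ -> _ => D (rot (set_val z))) dc).
apply: etrans (congr1 (fun w => dotp w _) dc) _.
exact: dotp_linear (circle_tangent eK).
Qed.

Lemma Diffp_circle1 : Diffp_circle R 1%g.
Proof.
apply: Diffp_circle_intro => [|z]; first exact: diffeo1.
exists id; first by apply: smooth_global => //; apply: smooth_on_id; exact: openT.
have [_ ->] := is_diff_id (set_val z).
by rewrite rot_dot [sqn _](set_valP z).
Qed.

Lemma Diffp_circleM g h :
  Diffp_circle R g -> Diffp_circle R h -> Diffp_circle R (g * h)%g.
Proof.
move=> [dg pg] [dh ph]; apply: Diffp_circle_intro => [|z]; first exact: diffeoM.
have [K eK] := dh.1 z; have [F eF] := dg.1 (h z).
exists (fun p => F (K p)); first exact: local_extension_comp eK eF.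
rewrite (circle_speed_comp eK eF) mulr_gt0 //; first exact: ph eK.
exact: pg eF.
Qed.

Lemma Diffp_circleV g : Diffp_circle R g -> Diffp_circle R g^-1%g.
Proof.
move=> [dg pg]; split=> [|z F eF]; first exact: diffeoV.
have [K eK] := dg.1 (g^-1%g z).
have eKF := local_extension_comp (j := set_val) (f := fun y => set_val (g y))
  (fin_dim_rV R 2) (fin_dim_rV R 2) eF eK.
have e1 : local_extension set_val (fun y => set_val (g (g^-1%g y))) z (id : plane -> plane).
  apply: smooth_global; first by apply: smooth_on_id; exact: openT.
  by move=> y; congr set_val; rewrite [RHS]sym_invK.
have gz : g (g^-1%g z) = z by exact: sym_invK.
have E1 : 'd id (set_val z) (rot (set_val z)) = rot (set_val z).
  by have [_ ->] := is_diff_id (set_val z).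
(* The speeds of [g^-1] and of [g] multiply to the speed of the identity, which is 1 on the unit
   circle. *)
have E := etrans (esym (circle_speed_comp eF eK))
  (congr1 (fun w => dotp w _) (etrans (circle_ext_diff eKF e1) E1)).
have pK := pg _ _ eK; move: E pK; rewrite gz rot_dot [sqn _](set_valP z) => E pK.
by rewrite -(pmulr_lgt0 _ pK) E.
Qed.

Lemma Diff_ar1 : Diff_ar (1%g : sym (cdisc R)).
Proof.
split; first exact: Diffp_disc1.
exists (1 / 2), 1%g; split; [by lra|exact: Diffp_circle1|by move=> r _ x z].
Qed.

Lemma scale_circle_disc (r : R) (z : circle R) : 0 <= r <= 1 ->
  cdisc R (r *: set_val z).
Proof.
move=> /andP[r0 r1]; rewrite cdiscE sqnZ [sqn _](set_valP z) mulr1.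
by rewrite expr_le1.
Qed.

Lemma radial_atM r (g g' : sym (cdisc R)) f f' : 0 <= r <= 1 ->
  radial_at r g f -> radial_at r g' f' -> radial_at r (g * g')%g (f * f')%g.
Proof.
by move=> r01 rg rg' x z xz; apply: rg; exact: rg'.
Qed.

Lemma radial_atV r (g : sym (cdisc R)) f : 0 <= r <= 1 ->
  radial_at r g f -> radial_at r g^-1%g f^-1%g.
Proof.
move=> r01 rg x z xz.
(* The disc point of radius [r] in the direction [f^-1 z]: [g] sends it to [x], so it is
   [g^-1 x]. *)
have [y yE] := set_valE (scale_circle_disc (f^-1%g z) r01).
have := rg _ _ yE; have -> : f (f^-1%g z) = z by exact: sym_invK.
rewrite -xz => /val_inj <-.
by have -> : g^-1%g (g y) = y by exact: sym_funK.
Qed.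

Lemma Diff_arM (g h : sym (cdisc R)) :
  Diff_ar g -> Diff_ar h -> Diff_ar (g * h)%g.
Proof.
move=> [pg [e [f [e01 pf rf]]]] [ph [e' [f' [e01' pf' rf']]]].
split; first exact: Diffp_discM.
exists (Num.min e e'), (f * f')%g; split.
- by rewrite lt_min gt_min; case/andP: e01 => -> ->; case/andP: e01' => ->.
- exact: Diffp_circleM.
move=> r /andP[r0 r1].
have [re re'] : 1 - e < r /\ 1 - e' < r.
  by move: r0; rewrite ltrBlDr -ltrBlDl lt_min => /andP[]; split; lra.
by apply: radial_atM; [lra|apply: rf; rewrite re|apply: rf'; rewrite re'].
Qed.

Lemma Diff_arV (g : sym (cdisc R)) : Diff_ar g -> Diff_ar g^-1%g.
Proof.
move=> [pg [e [f [e01 pf rf]]]].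
split; first exact: Diffp_discV.
exists e, f^-1%g; split=> //; first exact: Diffp_circleV.
by move=> r /[dup] r0 /rf; apply: radial_atV; lra.
Qed.

End Groups.

(** * Isotopies, restriction to the boundary, closedness *)

Section Isotopies.
Variable R : realType.
Notation plane := 'rV[R]_2.

Lemma smooth_pair (V W Z : normedModType R) (T : Type) (i : T -> V)
  (f : T -> W) (g : T -> Z) :
  smooth i f -> smooth i g -> smooth i (fun x => (f x, g x)).
Proof.
move=> sf sg x; have [F [U [oU Ux sF Ff]]] := sf x.
have [G [U' [oU' U'x sG Gg]]] := sg x.
exists (fun p => (F p, G p)), (U `&` U'); split => //; first exact: openI.
  apply: smooth_on_pair; first exact: openI.
    by apply: sub_smooth_on sF => p [].
  by apply: sub_smooth_on sG => p [].
by move=> y [Uy U'y]; rewrite Ff // Gg.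
Qed.

Definition cyl (xt : cdisc R * @unit_interval R) : plane * R :=
  (set_val xt.1, set_val xt.2).

Lemma smooth_cyl1 : smooth cyl (fun xt => set_val xt.1).
Proof.
move=> x; exists (fst_lin plane R); apply: smooth_global => //.
apply: smooth_on_linear; [exact: openT|exact: fst_lin_continuous|].
by apply: smooth_on_id; exact: openT.
Qed.

Lemma smooth_cyl2 : smooth cyl (fun xt => set_val xt.2).
Proof.
move=> x; exists (snd_lin plane R); apply: smooth_global => //.
apply: smooth_on_linear; [exact: openT|exact: snd_lin_continuous|].
by apply: smooth_on_id; exact: openT.
Qed.

Lemma Diff_ar0_1 : Diff_ar0 R 1%g.
Proof.
split; first exact: Diff_ar1.
exists (fun=> 1%g); split=> //; first exact: smooth_cyl1.
by move=> _; exact: Diff_ar1.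
Qed.

Lemma Diff_ar0M g h : Diff_ar0 R g -> Diff_ar0 R h -> Diff_ar0 R (g * h)%g.
Proof.
move=> [ag [G [sG aG G0 G1]]] [ah [H [sH aH H0 H1]]].
split; first exact: Diff_arM.
exists (fun t => (G t * H t)%g); split.
(* Joint smoothness in space and time: the product isotopy is the isotopy [G] composed with the
   level-preserving map of the cylinder given by [H]. *)
- pose k (xt : cdisc R * @unit_interval R) := (H xt.2 xt.1, xt.2).
  apply: (smooth_comp (j := cyl) (k := k) (f := fun xt => set_val (G xt.2 xt.1))).
  + by apply: smooth_pair => //; exact: smooth_cyl2.
  + exact: sG.
- by move=> t; exact: Diff_arM.
- by move=> t t0; rewrite G0 // H0 // mulg1.
- by move=> t t1; rewrite G1 // H1.
Qed.

Lemma flip_proof (t : @unit_interval R) : @unit_interval R (1 - set_val t).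
Proof. by have /andP[t0 t1] := set_valP t; apply/andP; rewrite subr_ge0 gerBl. Qed.

Definition flip (t : @unit_interval R) : @unit_interval R :=
  SigSub (mem_set (flip_proof t)).

Lemma flipE t : set_val (flip t) = 1 - set_val t.
Proof. by []. Qed.

(* If [H t] joins 1 to g then [H (1 - t) * g^-1] joins 1 to [g^-1]; unlike
   [(H t)^-1], this is smooth without the inverse function theorem. *)
Lemma Diff_ar0V g : Diff_ar0 R g -> Diff_ar0 R g^-1%g.
Proof.
move=> [ag [H [sH aH H0 H1]]]; split; first exact: Diff_arV.
exists (fun t => (H (flip t) * g^-1)%g); split.
- pose k (xt : cdisc R * @unit_interval R) := (g^-1%g xt.1, flip xt.2).
  apply: (smooth_comp (j := cyl) (k := k) (f := fun xt => set_val (H xt.2 xt.1))).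
  + apply: smooth_pair.
      apply: (smooth_comp (j := set_val) (k := fst) (f := fun x => set_val (g^-1%g x))).
      * exact: smooth_cyl1.
      * by case: ag => -[[_]].
    apply: (smooth_comp (j := fun xt => set_val xt.2) (k := id)
      (f := fun xt : cdisc R * @unit_interval R => 1 - set_val xt.2)).
      exact: smooth_cyl2.
    move=> xt; exists (fun t => 1 - t); apply: smooth_global => //.
    have oT : open [set: R] by exact: openT.
    by apply: smooth_onB => //; [exact: smooth_on_cst|exact: smooth_on_id].
  + exact: sH.
- by move=> t; apply: Diff_arM => //; exact: Diff_arV.
- by move=> t t0; rewrite H1 ?mulgV // flipE t0 subr0.
- by move=> t t1; rewrite H0 ?mul1g // flipE t1 subrr.
Qed.

Lemma subgroup_Diff_ar0 : subgroup (Diff_ar0 R).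
Proof.
by apply: subgroupP; [exact: Diff_ar0_1|exact: Diff_ar0M|exact: Diff_ar0V].
Qed.

Lemma subgroup_Diffp_circle : subgroup (Diffp_circle R).
Proof.
by apply: subgroupP;
  [exact: Diffp_circle1|exact: Diffp_circleM|exact: Diffp_circleV].
Qed.

Lemma Diff_ar0_restricts g : Diff_ar0 R g ->
  exists2 f, Diffp_circle R f & restricts_to_circle g f.
Proof.
move=> [[_ [e [f [/andP[e0 _] pf rf]]]] _]; exists f => // x z xz.
have r1 : radial_at 1 g f by apply: rf; lra.
by rewrite (r1 x z) scale1r.
Qed.

Lemma circle_lift (z : circle R) : exists x : cdisc R, set_val x = set_val z.
Proof. exact/set_valE/circle_disc/set_valP. Qed.

Lemma restricts_uniq (g : sym (cdisc R)) f f' :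
  restricts_to_circle g f -> restricts_to_circle g f' -> f = f'.
Proof.
move=> rf rf'; apply: sym_eq => z; have [x xz] := circle_lift z.
by apply: val_inj; rewrite -[LHS](rf _ _ xz); exact: rf'.
Qed.

Lemma restrictsM (g g' : sym (cdisc R)) f f' : restricts_to_circle g f ->
  restricts_to_circle g' f' -> restricts_to_circle (g * g')%g (f * f')%g.
Proof. by move=> rf rf' x z xz; apply: rf; exact: rf'. Qed.

Lemma restrictsV (g : sym (cdisc R)) f :
  restricts_to_circle g f -> restricts_to_circle g^-1%g f^-1%g.
Proof.
move=> rf x z xz; have [y yE] := circle_lift (f^-1%g z).
have := rf _ _ yE; have -> : f (f^-1%g z) = z by exact: sym_invK.
rewrite -xz => /val_inj <-.
by have -> : g^-1%g (g y) = y by exact: sym_funK.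
Qed.

(** Exhibits the boundary-fixing maps as the kernel of restriction; the subgroup and normality
    claims then follow from multiplicativity of restriction. *)
Lemma restricts1_boundary g : Diff_ar0 R g ->
  restricts_to_circle g 1%g <-> boundary_fixing R g.
Proof.
move=> Gg; split=> [r1|[_ gx] x z xz].
  split=> // x cx; have [z zE] := set_valE cx.
  by apply: val_inj; rewrite [LHS](r1 _ z).
by rewrite gx // xz; exact: set_valP.
Qed.

Lemma boundary_fixing_quotient g h f : Diff_ar0 R g -> Diff_ar0 R h ->
  restricts_to_circle g f -> restricts_to_circle h f ->
  boundary_fixing R (g^-1 * h)%g.
Proof.
move=> Gg Gh rg rh; apply/restricts1_boundary.
  by apply: Diff_ar0M => //; exact: Diff_ar0V.
by rewrite -(mulVg f); apply: restrictsM => //; exact: restrictsV.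
Qed.

Lemma normal_boundary_fixing :
  normal_subgroup (boundary_fixing R) (Diff_ar0 R).
Proof.
have sub : boundary_fixing R `<=` Diff_ar0 R by move=> g [].
split=> //.
  apply: subgroupP.
  - by split=> //; exact: Diff_ar0_1.
  - move=> g h Hg Hh; have [Gg Gh] := (sub _ Hg, sub _ Hh).
    apply/restricts1_boundary; first exact: Diff_ar0M.
    by rewrite -(mulg1 1%g); apply: restrictsM; exact/restricts1_boundary.
  - move=> g Hg; have Gg := sub _ Hg.
    apply/restricts1_boundary; first exact: Diff_ar0V.
    by rewrite -invg1; apply: restrictsV; exact/restricts1_boundary.
move=> g n Gg Hn; have Gn := sub _ Hn; have [f _ rf] := Diff_ar0_restricts Gg.
apply/restricts1_boundary.
  by apply: Diff_ar0M; [exact: Diff_ar0M|exact: Diff_ar0V].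
rewrite -(mulgV f) -{1}(mulg1 f); apply: restrictsM; last exact: restrictsV.
by apply: restrictsM => //; exact/restricts1_boundary.
Qed.

(** The extension picked inside [deriv_along] is immaterial here, since every local extension at [x]
    takes the value of the map at [x]. *)
Lemma jets_nil (g : sym (cdisc R)) x :
  smooth set_val (fun y => set_val (g y)) -> jets g [::] x = set_val (g x).
Proof.
move=> sg; rewrite /jets /deriv_along /=.
have := xgetPex (fun=> 0) (sg x); exact: local_extension_val.
Qed.

(** Fixing a given boundary point is a closed condition, because evaluation at a point is
    continuous: take the jets, project to the empty word, evaluate a uniform limit at [x]. *)
Lemma closed_boundary_fixing : closed_in (Diff_ar0 R) (boundary_fixing R).
Proof.
pose D := [set x : cdisc R | circle R (set_val x)].
pose C : set (cinfty_disc R) :=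
  \bigcap_(x in D) (fun g => jets g [::] x) @^-1` [set set_val x].
exists C.
  apply: closed_bigI => x _.
  apply: (continuous_closedP (fun g : cinfty_disc R => jets g [::] x)).1; last first.
    exact/accessible_closed_set1/hausdorff_accessible/norm_hausdorff.
  pose J := prod_topology (fun _ : seq plane => {uniform cdisc R -> plane}).
  have cproj : continuous (fun h : J => h [::]) by exact: proj_continuous.
  have cev : continuous (fun k : {uniform cdisc R -> plane} => k x).
    move=> k; have FF : Filter (nbhs k) by exact: nbhs_filter.
    rewrite /continuous_at -uniform_set1.
    by apply: (uniform_subset_cvg (A := setT)) => //; exact: cvg_id.
  have cjets : continuous (fun g : cinfty_disc R => jets g : J).
    exact: initial_continuous.
  move=> g; exact: (continuous_comp (continuous_comp (cjets g) (cproj _)) (cev _)).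
apply/seteqP; split=> [g [Gg gx]|g [Gg Cg]].
  split=> // x Dx /=; rewrite jets_nil ?gx //.
  by case: Gg => -[[[]]].
split=> // x Dx; have := Cg x Dx; rewrite /= jets_nil; first exact: val_inj.
by case: Gg => -[[[]]].
Qed.

End Isotopies.

(** * Lifts of circle diffeomorphisms *)

Section Angles.
Variable R : realType.
Notation plane := 'rV[R]_2.

Definition tau : R := pi *+ 2.

Lemma tau_gt0 : 0 < tau.
Proof. by rewrite pmulrn_lgt0 ?pi_gt0. Qed.

(** The point e^(it), obtained by rotating (1, 0) so that the lemmas on [turn] apply to it. *)
Definition cis (t : R) : plane := turn t (\row_j (j == 0)%:R).

Lemma cisE t : (cis t 0 0 = cos t) * (cis t 0 1 = sin t).
Proof. by rewrite /cis !turnE !mxE /= !mulr1 !mulr0 subr0 add0r. Qed.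

Lemma turn_cis s t : turn s (cis t) = cis (s + t).
Proof. by rewrite /cis turnD. Qed.

Lemma sqn_cis t : sqn (cis t) = 1.
Proof. by rewrite /sqn !cisE cos2Dsin2. Qed.

Lemma is_derive_cis (t : R) : is_derive t 1 cis (rot (cis t)).
Proof. exact: is_derive_turn. Qed.

Lemma smooth_cis : smooth_on [set: R] cis.
Proof.
have oT : open [set: R] by exact: openT.
have [ss sc] := smooth_sin_cos R.
by apply: smooth_onD => //; apply: smooth_onZ => //; exact: smooth_on_cst.
Qed.

Lemma cis_periodic (k : int) t : cis (t + k%:~R * tau) = cis t.
Proof.
have P n s : cis (s + n%:R * tau) = cis s.
  rewrite mulr_natl; apply: plane_eq; rewrite !cisE.
    exact: (periodicn (@cosD2pi R)).
  exact: (periodicn (@sinD2pi R)).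
case: k => n; first exact: P.
by rewrite NegzE -[LHS](P n.+1) mulrNz mulNr; congr cis; rewrite subrK.
Qed.

(** Modulo [tau] one may take y in [0, tau). The half-angle formula gives sin (y / 2) = 0, whereas
    the sine is positive on the open interval from 0 to pi. *)
Lemma cos_eq1 (x : R) : cos x = 1 -> exists k : int, x = k%:~R * tau.
Proof.
have t0 := tau_gt0.
pose k := Num.floor (x / tau); pose y := x - k%:~R * tau.
move=> cx; have cy : cos y = 1.
  have := cis_periodic (- k) x; rewrite mulrNz mulNr -/y.
  by move/(congr1 (fun p : plane => p 0 0)); rewrite !cisE cx.
exists k; apply/eqP; rewrite -subr_eq0 -/y.
have /andP[y0 yt] : 0 <= y < tau.
  have /andP[k1 k2] := floor_itv (x / tau); rewrite -/k in k1 k2.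
  rewrite /y subr_ge0 ltrBlDl -ler_pdivlMr // k1 /=.
  by rewrite -[X in _ + X]mul1r -mulrDl -ltr_pdivrMr // -(intrD _ k 1).
have yE : y = (y / 2) *+ 2 by rewrite -mulr_natr divfK ?pnatr_eq0.
have c2 : cos (y / 2) ^+ 2 *+ 2 - 1 = 1 by rewrite -cos_mulr2n -yE.
have s0 : sin (y / 2) = 0.
  by apply/eqP; rewrite -sqrf_eq0 sin2cos2; apply/eqP; move: c2; lra.
apply: contraT => ny0.
have y0' : 0 < y by rewrite lt_neqAle eq_sym ny0.
have : 0 < sin (y / 2).
  by apply: sin_gt0_pi; rewrite divr_gt0 //= ltr_pdivrMr // mulr_natr.
by rewrite s0 ltxx.
Qed.

Lemma cis_inj s t : cis s = cis t -> exists k : int, s = t + k%:~R * tau.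
Proof.
move=> E; have [|k kE] := @cos_eq1 (s - t).
  have E0 := congr1 (fun p : plane => p 0 0) E; have E1 := congr1 (fun p : plane => p 0 1) E.
  rewrite !cisE in E0 E1.
  by rewrite cosB E0 E1 -!expr2 cos2Dsin2.
by exists k; rewrite -kE addrC subrK.
Qed.

Lemma circle_polar (p : plane) : sqn p = 1 -> exists t, p = cis t.
Proof.
rewrite /sqn => p1.
have x1 : -1 <= p 0 0 <= 1.
  rewrite -ler_norml -(@ler_pXn2r _ 2) ?nnegrE // expr1n real_normK ?num_real //.
  by rewrite -p1 lerDl sqr_ge0.
have yE : Num.sqrt (1 - p 0 0 ^+ 2) = `|p 0 1|.
  by rewrite -p1 addrC addKr sqrtr_sqr.
have [y0|y0] := lerP 0 (p 0 1).
  exists (acos (p 0 0)); apply: plane_eq; rewrite cisE ?acosK //.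
  by rewrite sin_acos // yE ger0_norm.
exists (- acos (p 0 0)); apply: plane_eq; rewrite cisE ?cosN ?acosK //.
by rewrite sinN sin_acos // yE ltr0_norm // opprK.
Qed.

Lemma polar (p : plane) : p != 0 ->
  exists r t, [/\ 0 < r, p = r *: cis t & r ^+ 2 = sqn p].
Proof.
move=> /sqn_gt0 p0; pose r := Num.sqrt (sqn p).
have r0 : 0 < r by rewrite sqrtr_gt0.
have r2 : r ^+ 2 = sqn p by rewrite sqr_sqrtr // ltW.
have [|t tE] := @circle_polar (r^-1 *: p).
  by rewrite sqnZ exprVn r2 mulVf // gt_eqF.
by exists r, t; split=> //; rewrite -tE scalerA mulfV ?scale1r // gt_eqF.
Qed.

End Angles.

Section Antiderivative.
Variable R : realType.
Notation mu := (@lebesgue_measure R).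

Lemma antiderivative (w : R -> R) : continuous w ->
  exists F : R -> R, forall x : R, is_derive x 1 F (w x).
Proof.
move=> cw.
have iw (a b : R) : mu.-integrable `[a, b] (EFin \o w).
  apply: continuous_compact_integrable; first exact: segment_compact.
  exact: continuous_subspaceT.
pose I (a x : R) : R := (\int[mu]_(t in `[a, x]) w t)%R.
have IB (a b x : R) : a <= b -> b <= x -> I a x - I a b = I b x.
  move=> ab bx; rewrite /I Rintegral_itvB ?bnd_simp //.
  rewrite Rintegral_itv_obnd_cbnd //; apply: integrableS (iw b x) => //.
  by apply: subset_itvr; rewrite bnd_simp.
(* The integral needs a base point to the left of both [x] and 0, so the base point moves with [x];
   subtracting the integral up to 0 makes the value independent of it, which is [FE]. *)
pose F (x : R) := I (- `|x| - 1) x - I (- `|x| - 1) 0.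
have FE (a x : R) : a <= - `|x| - 1 -> F x = I a x - I a 0.
  move=> ax; rewrite /F; set b := - `|x| - 1 in ax *.
  have bx : b <= x by rewrite /b lerBlDr; have := ler_norm (- x); rewrite normrN; lra.
  have b0 : b <= 0 by rewrite /b; have := normr_ge0 x; lra.
  by rewrite -(IB _ _ _ ax bx) -(IB _ _ _ ax b0); ring.
(* One unit to spare: this [a] is an admissible base point for every [y] at distance less than 1
   from [x]. *)
exists F => x; pose a := - `|x| - 2.
have ax : a < x by rewrite /a; have := ler_norm (- x); rewrite normrN; lra.
have xx : x < x + 1 by rewrite ltrDl.
have [dI IE] := continuous_FTC1_closed xx (iw _ _) ax (cw x).
have dI' : is_derive x 1 (I a) (w x).
  apply: DeriveDef; first exact: dI.
  exact: etrans (esym (derive1E _ _)) IE.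
have dC : is_derive x 1 (fun y => I a y - I a 0) (w x).
  have := is_deriveB dI' (is_derive_cst (I a 0) x (1 : R)).
  by rewrite subr0.
apply: near_eq_is_derive dC.
have : nbhs x (ball x 1) by exact: nbhsx_ballx.
apply: filterS => y; rewrite /ball /= => xy; apply/esym/FE.
by have := lerB_dist y x; rewrite distrC /a; lra.
Qed.

End Antiderivative.

(** * The lift of a circle diffeomorphism *)

Section Lift.
Variable R : realType.
Notation plane := 'rV[R]_2.
Notation tau := (tau R).

Lemma is_derive_smooth (W : normedModType R) (F : R -> W) (x : R) :
  smooth_on setT F -> is_derive x 1 F ('d F x 1).
Proof.
move=> sF; have dF := smooth_on_differentiable sF (I : setT x).
by apply: DeriveDef; [exact/derivable1_diffP|rewrite deriveE].
Qed.

Lemma pos_derive_lt (f df : R -> R) : (forall x : R, is_derive x 1 f (df x)) ->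
  (forall x, 0 < df x) -> {homo f : x y / x < y}.
Proof.
move=> dfE df0 x y xy.
have cf : continuous f.
  by move=> z; apply/differentiable_continuous/derivable1_diffP; case: (dfE z).
have [|c _ fE] := MVT xy (fun z _ => dfE z); first exact: continuous_subspaceT.
by rewrite -subr_gt0 fE mulr_gt0 // subr_gt0.
Qed.

Definition circle_cis (t : R) : circle R := SigSub (mem_set (sqn_cis t)).

Lemma circle_cisE t : set_val (circle_cis t) = cis t.
Proof. by []. Qed.

Variable f : sym (circle R).
Hypothesis pf : Diffp_circle R f.

Let h (t : R) : plane := set_val (f (circle_cis t)).

Let hE t F : local_extension set_val (fun y => set_val (f y)) (circle_cis t) F ->
  \forall s \near t, F (cis s) = h s.
Proof.
move=> ext; have eF := local_extension_near ext.
have ct := @smooth_continuous _ _ _ _ (@smooth_cis R) t.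
have : \forall s \near t, forall y, set_val y = cis s -> F (cis s) = set_val (f y).
  exact: ct _ eF.
by apply: filterS => s; apply.
Qed.

Let smooth_h : smooth_on setT h.
Proof.
apply: smooth_on_local => t _; have [F eF] := pf.1.1 (circle_cis t).
have [U [oU Ut sF FU]] := eF.
have oT : open [set: R] by exact: openT.
have oI := open_preimage_smooth oT oU (@smooth_cis R).
exists ([set: R] `&` (@cis R) @^-1` U) => //.
apply: (eq_smooth_on oI (F := fun s => F (cis s))).
  by move=> s [_ Us]; exact: (FU (circle_cis s) Us).
apply: (smooth_on_comp (U' := U)) => //; first by move=> s [].
by apply: sub_smooth_on (@smooth_cis R) => s [].
Qed.

(** Angular speed of [f] at e^(it). Since [h] moves on the circle, h' = w i h, and the orientation
    condition on [f] is w > 0. *)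
Let w (t : R) : R := dotp ('d h t 1) (rot (h t)).

Let sqn_h t : sqn (h t) = 1.
Proof. exact: (set_valP (f (circle_cis t))). Qed.

Let dh (t : R) : is_derive t 1 h (w t *: rot (h t)) /\ 0 < w t.
Proof.
have [F eF] := pf.1.1 (circle_cis t).
have T := circle_tangent eF; have P := pf.2 _ _ eF.
have dc := is_derive_cis t.
have dF := is_derive_comp dc (local_extension_differentiable eF).
have dh' := near_eq_is_derive (hE eF) dF.
have [_ E1] := is_derive_smooth t smooth_h; have [_ E2] := dh'.
have E : 'd h t 1 = 'd F (cis t) (rot (cis t)) := etrans (esym E1) E2.
have wE : w t = dotp ('d F (cis t) (rot (cis t))) (rot (h t)).
  exact: (congr1 (fun v => dotp v (rot (h t))) E).
split; last by rewrite wE; exact: P.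
apply: is_derive_eq dh' _; rewrite wE; exact: T.
Qed.

Let smooth_w : smooth_on setT w.
Proof.
have oT : open [set: R] by exact: openT.
have sd := smooth_on_diff (1 : R) smooth_h.
apply: (@eq_smooth_on _ _ _ _ (fun t =>
  ('d h t 1) 0 0 * - h t 0 1 + ('d h t 1) 0 1 * h t 0 0)) => //.
  by move=> t _; rewrite /w dotpE !rotE.
apply: smooth_onD => //; apply: smooth_onM => //; try exact: smooth_on_coord.
by apply: smooth_onN => //; exact: smooth_on_coord.
Qed.

(** The lift is the antiderivative of [w] that starts at an angle of [h 0]. Its increment over a
    period is a multiple of [tau]; monotonicity makes the multiple positive, and injectivity of [f]
    excludes 2 or more. *)
Lemma circle_lift_exists : exists phi dphi : R -> R,
  [/\ smooth_on setT phi,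
      forall x : R, is_derive x 1 phi (dphi x),
      forall x, 0 < dphi x,
      forall t, set_val (f (circle_cis t)) = cis (phi t) &
      forall t, phi (t + tau) = phi t + tau].
Proof.
have [|Phi dPhi] := @antiderivative R w.
  exact: smooth_continuous smooth_w.
have [p0 p0E] := circle_polar (sqn_h 0).
pose phi t := Phi t + (p0 - Phi 0).
have dphi (x : R) : is_derive x 1 phi (w x).
  have := is_deriveD (dPhi x) (is_derive_cst (p0 - Phi 0) x (1 : R)).
  by rewrite addr0.
have w0 x : 0 < w x by have [] := dh x.
have sphi : smooth_on setT phi.
  by apply: (smooth_on_deriv (f' := w)) => //; exact: openT.
have lift t : h t = cis (phi t).
  (* [A] is the inner product of [h] and e^(i phi). Both turn with speed [w], so it is constant,
     equal to 1 at time 0; two unit vectors with inner product 1 coincide. *)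
  pose A s := h s 0 0 * cos (phi s) + h s 0 1 * sin (phi s).
  have dA (s : R) : is_derive s 1 A 0.
    have [dhs _] := dh s.
    have d0 := is_derive_coord 0 dhs; have d1 := is_derive_coord 1 dhs.
    have dc := is_derive1_comp (is_derive_cos (phi s)) (dphi s).
    have ds := is_derive1_comp (is_derive_sin (phi s)) (dphi s).
    apply: is_derive_eq (is_deriveD (is_deriveM d0 dc) (is_deriveM d1 ds)) _.
    by rewrite !mxE /GRing.scale /=; ring.
  have A1 : A t = 1.
    rewrite (is_derive_0_is_cst t 0 dA) /A.
    have -> : phi 0 = p0 by rewrite /phi addrC subrK.
    by rewrite p0E !cisE -!expr2 cos2Dsin2.
  have := sqn_h t; have := cos2Dsin2 (phi t); rewrite /sqn => c1 h1.
  have H : (h t 0 0 - cos (phi t)) ^+ 2 + (h t 0 1 - sin (phi t)) ^+ 2 = 0.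
    transitivity ((h t 0 0 ^+ 2 + h t 0 1 ^+ 2) +
      (cos (phi t) ^+ 2 + sin (phi t) ^+ 2) - 2 * A t); first by rewrite /A; ring.
    by rewrite h1 c1 A1; ring.
  move/eqP: H; rewrite paddr_eq0 ?sqr_ge0 // !sqrf_eq0 !subr_eq0 => /andP[/eqP H0 /eqP H1].
  by apply: plane_eq; rewrite cisE.
have mono := pos_derive_lt dphi w0.
have t0 := tau_gt0 R.
exists phi, w; split=> // t.
have cisT s : cis (s + tau) = cis s by have := cis_periodic 1 s; rewrite mul1r.
have [k kE] : exists k : int, phi (t + tau) = phi t + k%:~R * tau.
  apply: cis_inj; rewrite -!lift; congr (set_val (f _)).
  by apply: val_inj; rewrite [LHS]cisT.
have k0 : 0 < k.
  have := mono t (t + tau); rewrite ltrDl => /(_ t0); rewrite kE ltrDl.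
  by rewrite pmulr_lgt0 // ltr0z.
have [k1|k2] := leP k 1.
  have k1' : k = 1 by apply/eqP; rewrite eq_le k1 -gtz0_ge1.
  by rewrite kE k1' mul1r.
have ph2 : phi t + tau < phi (t + tau).
  by rewrite kE ltrD2l -{1}[tau]mul1r ltr_pM2r // ltr1z.
(* For a multiple of at least 2, [phi] would reach [phi t + tau] strictly inside the period, where
   [f] would repeat its value at [t]. *)
have [|||x xI xE] := @IVT R phi t (t + tau) (phi t + tau).
- by rewrite lerDl ltW.
- by apply: continuous_subspaceT; exact: smooth_continuous sphi.
- rewrite ge_min le_max lerDl ltW //=; apply/orP; right; exact: ltW.
have [j jE] : exists j : int, x = t + j%:~R * tau.
  apply: cis_inj; have hx : h x = h t by rewrite !lift xE -[tau]mul1r (cis_periodic 1).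
  have /(congr1 (sym_inv f)) := val_inj hx.
  by rewrite !sym_funK => /(congr1 set_val).
have xt : x != t by apply: contra_eq_neq xE => ->; rewrite lt_eqF // ltrDl.
have xtt : x != t + tau.
  by apply: contra_eq_neq xE => ->; rewrite gt_eqF.
have : t < x < t + tau.
  by move: xI; rewrite in_itv /= !le_eqVlt eq_sym (negPf xt) (negPf xtt).
rewrite jE ltrDl ltrD2l pmulr_lgt0 // ltr0z -[X in _ && (_ < X)]mul1r ltr_pM2r // ltrz1.
by case/andP; rewrite gtz0_ge1 leNgt => /negPf ->.
Qed.

End Lift.

(** * Smoothness of inverse maps of the plane *)

Section InverseFunction.
Variable R : realType.
Notation plane := 'rV[R]_2.

(** With h = G (y + k) - G y one has k = dF h + r and r = o(h), so L k = h + L r and the error is -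
    L r. Continuity of [G] makes h small, and absorbing L r then bounds |h| by a multiple of |k|. *)
Lemma is_diff_inverse (V W : normedModType R) (F : V -> W) (G : W -> V) y
  (L : {linear W -> V}) : (forall z, F (G z) = z) -> {for y, continuous G} ->
  differentiable F (G y) -> continuous L -> (forall v, L ('d F (G y) v) = v) ->
  is_diff y G L.
Proof.
move=> FG cG dF cL LK; set x := G y in dF LK *.
have [C C0 HC] := linear_lipschitz cL.
have key : G \o shift y = cst (G y) + L +o_ 0 id.
  apply/eqaddoP => e e0; rewrite -/x.
  (* The first bound gives C d <= 1/2, hence |h| <= 2 C |k|; the second then turns C d |h| into at
     most e |k|. *)
  pose d := Num.min (2 * C)^-1 (e / (2 * C * C)).
  have d0 : 0 < d by rewrite lt_min invr_gt0 divr_gt0 ?mulr_gt0.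
  have /eqaddoP/(_ d d0) H := diff_locally dF.
  have cG' : G (k + y) - x @[k --> (0 : W)] --> (0 : V).
    rewrite -[X in _ --> X](subrr x); apply: cvgB; last exact: cvg_cst.
    have : {for 0, continuous (fun k : W => G (k + y))}.
      apply: (@continuous_comp _ _ _ (fun k => k + y) G); last by rewrite add0r.
      by apply: cvgD; [exact: cvg_id|exact: cvg_cst].
    by rewrite /prop_for /continuous_at add0r.
  have H' : \forall k \near (0 : W),
      `|F (G (k + y) - x + x) - (F x + 'd F x (G (k + y) - x))| <=
      d * `|G (k + y) - x| := cG' _ H.
  apply: filterS H' => k; rewrite /= !fctE /= subrK FG /x FG -/x.
  move: (G (k + y)) => z; set h := z - x; set r := k + y - (y + 'd F x h) => Hr.
  have rE : L k = h + L r.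
    by rewrite /r opprD addrA addrK linearB LK addrC subrK.
  have -> : z - (x + L k) = - L r by rewrite rE opprD addrA -/h opprD addNKr.
  rewrite normrN.
  have HL : `|L r| <= C * d * `|h|.
    by rewrite (le_trans (HC r)) // -mulrA ler_pM2l.
  have Cd : C * d <= 2^-1.
    by rewrite -ler_pdivlMl // /d ge_min invfM mulrC lexx.
  have Hh : `|h| <= 2 * (C * `|k|).
    have h1 : `|h| <= `|L k| + `|L r|.
      by rewrite -[in leLHS](addrK (L r) h) -rE (le_trans (ler_normB _ _)).
    have h2 := HC k.
    have h3 : C * d * `|h| <= 2^-1 * `|h| by rewrite ler_wpM2r.
    lra.
  have d2 : d <= e / (2 * C * C) by rewrite /d ge_min lexx orbT.
  apply: (le_trans HL); apply: (@le_trans _ _ (C * (e / (2 * C * C)) * (2 * (C * `|k|)))).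
    by apply: ler_pM => //; rewrite ?mulr_ge0 ?(ltW C0) ?(ltW d0) // ler_wpM2l // ltW.
  rewrite le_eqVlt; apply/orP; left; apply/eqP; field.
  by rewrite gt_eqF.
have dGE : 'd G y = L :> (W -> V) by exact: diff_unique.
apply: DiffDef => //; apply/diff_locallyP; rewrite dGE; split => //.
Qed.

Definition crossp (u v : plane) : R := u 0 0 * v 0 1 - u 0 1 * v 0 0.

Lemma plane_sum (v : plane) : v = v 0 0 *: delta_mx 0 0 + v 0 1 *: delta_mx 0 1.
Proof. by apply: plane_eq; rewrite !mxE /= ?mulr1 ?mulr0 ?addr0 ?add0r. Qed.

Lemma lin2_linear (P Q : plane) : linear (fun w : plane => w 0 0 *: P + w 0 1 *: Q).
Proof.
by move=> a u v; rewrite !mxE !scalerDl scalerDr !scalerA addrACA.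
Qed.

Definition lin2 (P Q : plane) : {linear plane -> plane} :=
  HB.pack (fun w : plane => w 0 0 *: P + w 0 1 *: Q)
    (GRing.isLinear.Build _ _ _ _ _ (lin2_linear P Q)).

Lemma lin2_continuous P Q : continuous (lin2 P Q).
Proof.
have h (S : plane) j : continuous (fun w : plane => w 0 j *: S).
  move=> w; apply: (@continuous_comp _ _ _ (fun w : plane => w 0 j) (fun a => a *: S)).
    exact: coord_continuous.
  exact: scalel_continuous.
by move=> w; exact: (continuousD (h P 0 w) (h Q 1 w)).
Qed.

Section Cramer.
Variable g : plane -> plane.
Let A x := 'd g x (delta_mx 0 0).
Let B x := 'd g x (delta_mx 0 1).
Let J x := crossp (A x) (B x).
(** By Cramer's rule, [P x] and [Q x] are the images of the two basis vectors under the inverse of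
    the differential of [g] at [x]. *)
Let P x : plane := \row_j (if j == 0 then B x 0 1 / J x else - A x 0 1 / J x).
Let Q x : plane := \row_j (if j == 0 then - B x 0 0 / J x else A x 0 0 / J x).

Lemma smooth_inverse (g' : plane -> plane) : smooth_on setT g ->
  (forall y, g (g' y) = y) -> continuous g' ->
  (forall x, crossp ('d g x (delta_mx 0 0)) ('d g x (delta_mx 0 1)) != 0) ->
  smooth_on setT g'.
Proof.
move=> sg gK cg J0; have oT : open [set: plane] by exact: openT.
have sA i := smooth_on_diff (delta_mx 0 i) sg.
have sJ : smooth_on setT (fun x => (J x)^-1).
  apply: (smooth_onV oT (F := J)); first by move=> x _; exact: J0.
  have : smooth_on setT (fun x => A x 0 0 * B x 0 1 - A x 0 1 * B x 0 0).
    apply: smooth_onB => //; apply: smooth_onM => //;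
      by apply: smooth_on_coord => //; exact: sA.
  exact.
have sP : smooth_on setT P.
  apply: (smooth_on_row (F := fun x (j : 'I_2) =>
    if j == 0 then B x 0 1 / J x else - A x 0 1 / J x)) => // j.
  case: (j == 0); apply: smooth_onM => //; first by apply: smooth_on_coord => //; exact: sA.
  by apply: smooth_onN => //; apply: smooth_on_coord => //; exact: sA.
have sQ : smooth_on setT Q.
  apply: (smooth_on_row (F := fun x (j : 'I_2) =>
    if j == 0 then - B x 0 0 / J x else A x 0 0 / J x)) => // j.
  case: (j == 0); apply: smooth_onM => //; last by apply: smooth_on_coord => //; exact: sA.
  by apply: smooth_onN => //; apply: smooth_on_coord => //; exact: sA.
have dg' y : is_diff y g' (lin2 (P (g' y)) (Q (g' y))).
  have dg : differentiable g (g' y) by exact: (smooth_on_differentiable sg).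
  apply: is_diff_inverse dg _ _ => //; [exact: cg|exact: lin2_continuous|] => v.
  have -> : 'd g (g' y) v = v 0 0 *: A (g' y) + v 0 1 *: B (g' y).
    by rewrite {1}(plane_sum v) linearD !linearZ.
  have := J0 (g' y); rewrite -/(J _) /lin2 /= /P /Q /J /crossp -/(A _) -/(B _).
  move: (A _) (B _) => a b j0.
  by apply: plane_eq; rewrite !mxE /=; field.
apply/smooth_onP; elim=> [|k IH]; first exact: Cn0.
apply: (CnS_diff oT (fun y _ => dg' y)) => v.
(* The differential of [g'] has coefficients [P] and [Q] evaluated at [g' y]; these inherit the
   order already known for [g']. *)
have cmp (S : plane -> plane) : smooth_on setT S -> Cn k setT (fun y => S (g' y)).
  by move=> /smooth_onP sS; apply: (@Cn_comp _ _ _ _ _ setT setT g' S).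
apply: CnD => //; apply: CnZ => //; try exact: Cn_cst; exact: cmp.
Qed.
End Cramer.

Lemma smooth_sqn : smooth_on [set: plane] (@sqn R).
Proof.
have oT : open [set: plane] by exact: openT.
have sc j : smooth_on [set: plane] (fun p => p 0 j).
  by apply: smooth_on_coord => //; exact: smooth_on_id.
by apply: smooth_onD => //; apply: smooth_onM => //; exact: sc.
Qed.

Lemma sqn_continuous : continuous (@sqn R).
Proof. exact: smooth_continuous smooth_sqn. Qed.

(** Near [y] the values of [g'] stay in a compact box because norms are preserved. Continuity of [g]
    sends any cluster point of them to [y], so [g' y] is the only one, and in a compact set this
    means convergence. *)
Lemma inverse_continuous (g g' : plane -> plane) : continuous g ->
  cancel g g' -> cancel g' g -> (forall p, sqn (g' p) = sqn p) -> continuous g'.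
Proof.
(* Since M >= 1, a squared coordinate below M is also below M^2, so the box of half-width M contains
   all points with [sqn p < M]. *)
move=> cg gK g'K sg y; pose M := sqn y + 1.
have M1 : 1 <= M by rewrite lerDr sqn_ge0.
pose V := [set v : plane | forall i, `[- M, M]%classic (v ord0 i)].
have cV : compact V.
  apply: (@rV_compact _ _ (fun _ => `[- M, M]%classic)) => i; exact: segment_compact.
have bV (p : plane) : sqn p < M -> V p.
  move=> pM i; rewrite /= in_itv /= -ler_norml.
  rewrite -(@ler_pXn2r _ 2) ?nnegrE ?normr_ge0 ?(le_trans ler01) //.
  rewrite real_normK ?num_real // (le_trans _ (_ : M <= _)) //; last first.
    by rewrite expr2 ler_peMr // (le_trans ler01).
  rewrite (le_trans _ (ltW pM)) //; have [->|->] := ord2P i.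
    by rewrite lerDl sqr_ge0.
  by rewrite lerDr sqr_ge0.
have nbM (q : plane) : sqn q < M -> \forall p \near q, sqn p < M.
  by move=> qM; exact: (@sqn_continuous q _ (lt_nbhsl qM)).
have yM : sqn y < M by rewrite ltrDl.
have FV : (g' @ y) V.
  by apply: filterS (nbM y yM) => p pM; apply: bV; rewrite sg.
have PF : ProperFilter (g' @ y) by apply: fmap_proper_filter; exact: nbhs_pfilter.
have clE z : cluster (g' @ y) z -> z = g' y.
  move=> clz; apply: (can_inj gK); rewrite g'K; apply/esym/(@norm_hausdorff _ plane).
  move=> A B nA nB.
  have [|//|w [[p Ap pw] Bw]] := clz (g' @` A) (g @^-1` B); first 1 last.
  - exact: cg.
  - by exists p; split=> //; rewrite -(g'K p) pw.
  by apply: filterS nA => p Ap; exists p.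
apply: (compact_cluster_set1 (@norm_hausdorff _ plane) cV) => //.
  by apply: filterS (nbM _ (_ : sqn (g' y) < M)) => [p|]; [exact: bV|rewrite sg].
apply/seteqP; split=> [z /clE//|_ ->].
have [z [_ clz]] := cV (g' @ y) PF FV.
by rewrite -(clE _ clz).
Qed.

End InverseFunction.

(** * Extension of circle diffeomorphisms to the disc *)

Section RadialExtension.
Variable R : realType.
Notation plane := 'rV[R]_2.
Notation tau := (tau R).

Lemma sqn0 : sqn (0 : plane) = 0.
Proof. by rewrite /sqn !mxE expr0n addr0. Qed.

Lemma smooth_turn (V : normedModType R) (U : set V) (s : V -> R) (F : V -> plane) :
  open U -> smooth_on U s -> smooth_on U F -> smooth_on U (fun x => turn (s x) (F x)).
Proof.
move=> oU ss sF; have oT : open [set: R] by exact: openT.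
have [ssin scos] := @smooth_sin_cos R.
apply: smooth_onD => //; apply: smooth_onZ => //.
- exact: (smooth_on_comp (U' := setT) (F := s) (G := @cos R)).
- exact: (smooth_on_comp (U' := setT) (F := s) (G := @sin R)).
apply: (smooth_on_row (F := fun x (j : 'I_2) => if j == 0 then - F x 0 1 else F x 0 0)) => // j.
case: (j == 0); last exact: smooth_on_coord.
by apply: smooth_onN => //; exact: smooth_on_coord.
Qed.

(** Product rule for e^(i s(p)) p, read off coordinatewise on the line h |-> p + h v. *)
Lemma diff_turn (s : plane -> R) (p v : plane) : smooth_on setT s ->
  'd (fun q => turn (s q) q) p v = turn (s p) (v + 'd s p v *: rot p).
Proof.
move=> ss; have oT : open [set: plane] by exact: openT.
pose g q := turn (s q) q.
have sg : smooth_on setT g by apply: smooth_turn => //; exact: smooth_on_id.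
pose c (h : R) : plane := p + h *: v.
have c0 : c 0 = p by rewrite /c scale0r addr0.
have dc : is_derive (0 : R) 1 c v.
  have := is_deriveD (is_derive_cst p 0 (1 : R)) (is_derive_scalel v (is_derive_id 0 (1 : R))).
  by rewrite add0r scale1r.
have dg : differentiable g (c 0) by exact: (smooth_on_differentiable sg).
have ds : differentiable s (c 0) by exact: (smooth_on_differentiable ss).
have Dg := is_derive_comp dc dg; have Ds := is_derive_comp dc ds.
have Dcos := is_derive1_comp (is_derive_cos (s (c 0))) Ds.
have Dsin := is_derive1_comp (is_derive_sin (s (c 0))) Ds.
have D0 := is_derive_coord 0 dc; have D1 := is_derive_coord 1 dc.
have [_ E0] := is_derive_coord 0 Dg; have [_ E1] := is_derive_coord 1 Dg.
have [_ F0] := is_deriveB (is_deriveM Dcos D0) (is_deriveM Dsin D1).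
have [_ F1] := is_deriveD (is_deriveM Dcos D1) (is_deriveM Dsin D0).
rewrite c0 in E0 E1 F0 F1.
apply: plane_eq.
  apply: etrans (esym E0) _.
  have -> : (fun h => g (c h) 0 0) = ((@cos R) \o (fun h => s (c h))) * (fun h => c h 0 0)
     - ((@sin R) \o (fun h => s (c h))) * (fun h => c h 0 1).
    by apply/funext => h; rewrite /g turnE.
  by rewrite F0 turnE !mxE /= ?c0 /GRing.scale /=; ring.
apply: etrans (esym E1) _.
have -> : (fun h => g (c h) 0 1) = ((@cos R) \o (fun h => s (c h))) * (fun h => c h 0 1)
     + ((@sin R) \o (fun h => s (c h))) * (fun h => c h 0 0).
  by apply/funext => h; rewrite /g turnE.
by rewrite F1 turnE !mxE /= ?c0 /GRing.scale /=; ring.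
Qed.

Lemma crossp_turn t (u v : plane) : crossp (turn t u) (turn t v) = crossp u v.
Proof.
rewrite /crossp !turnE; move: (u 0 0) (u 0 1) (v 0 0) (v 0 1) => a b c d.
have H := cos2Dsin2 t; rewrite -[RHS]mul1r -H; ring.
Qed.

(** Up to a rotation, of determinant 1, the differential is v |-> v + ds(v) i p, a rank-one
    perturbation of the identity. *)
Lemma crossp_diff_turn (s : plane -> R) p : smooth_on setT s ->
  crossp ('d (fun q => turn (s q) q) p (delta_mx 0 0))
         ('d (fun q => turn (s q) q) p (delta_mx 0 1)) = 1 + 'd s p (rot p).
Proof.
move=> ss.
have E : 'd s p (rot p) = - p 0 1 * 'd s p (delta_mx 0 0) + p 0 0 * 'd s p (delta_mx 0 1).
  by rewrite [X in 'd s p X = _]plane_sum linearD !linearZ !rotE.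
rewrite E.
transitivity (crossp (turn (s p) (delta_mx 0 0 + 'd s p (delta_mx 0 0) *: rot p))
  (turn (s p) (delta_mx 0 1 + 'd s p (delta_mx 0 1) *: rot p))).
  by congr crossp; exact: diff_turn.
by rewrite crossp_turn /crossp !mxE /=; ring.
Qed.

Lemma diff_turn_rot (s : plane -> R) p : smooth_on setT s ->
  'd (fun q => turn (s q) q) p (rot p) = (1 + 'd s p (rot p)) *: rot (turn (s p) p).
Proof.
move=> ss; apply: etrans (diff_turn _ _ ss) _.
by rewrite -{1}[rot p]scale1r -scalerDl turnZ turn_rot.
Qed.

Variables phi dphi : R -> R.
Hypothesis smooth_phi : smooth_on setT phi.
Hypothesis is_derive_phi : forall x : R, is_derive x 1 phi (dphi x).
Hypothesis dphi_gt0 : forall x, 0 < dphi x.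
Hypothesis phi_tau : forall t, phi (t + tau) = phi t + tau.

Let u t := phi t - t.

Let smooth_u : smooth_on setT u.
Proof.
by apply: smooth_onB => //; [exact: openT|apply: smooth_on_id; exact: openT].
Qed.

Let is_derive_u (x : R) : is_derive x 1 u (dphi x - 1).
Proof. exact: (is_deriveB (is_derive_phi x) (is_derive_id x (1 : R))). Qed.

Let u_periodic (k : int) t : u (t + k%:~R * tau) = u t.
Proof.
have ut : periodic u tau by move=> s; rewrite /u phi_tau; ring.
have P n s : u (s + n%:R * tau) = u s by rewrite mulr_natl; exact: periodicn.
case: k => n; first exact: P.
by rewrite NegzE -[LHS](P n.+1) mulrNz mulNr; congr u; rewrite subrK.
Qed.

(** This is u (arg p) without a branch of the argument: any angle of [p] may be picked because [u]
    is periodic. The origin has no angle and gets the default 0, which the step hides. *)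
Definition angle_shift (p : plane) : R :=
  xget 0 [set v | exists r t, [/\ 0 < r, p = r *: cis t & v = u t]].

Lemma polar_uniq (r r' t t' : R) : 0 < r -> 0 < r' ->
  r *: cis t = r' *: cis t' -> r = r' /\ cis t = cis t'.
Proof.
move=> r0 r'0 E; have rr : r = r'.
  have := congr1 (@sqn R) E; rewrite !sqnZ !sqn_cis !mulr1 => /eqP.
  by rewrite eqrXn2 // ?ltW // => /eqP.
split=> //; rewrite -rr in E.
by have := congr1 (fun p => r^-1 *: p) E; rewrite !scalerA mulVf ?gt_eqF // !scale1r.
Qed.

Lemma angle_shiftE r t : 0 < r -> angle_shift (r *: cis t) = u t.
Proof.
move=> r0; rewrite /angle_shift.
set P := [set v | _].
have [|r' [t' [r'0 E ->]]] := @xgetPex _ 0 P; first by exists (u t), r, t.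
have [_ /cis_inj[k ->]] := polar_uniq r0 r'0 E.
by rewrite u_periodic.
Qed.

Lemma smooth_angle_shift : smooth_on [set p | p != 0] angle_shift.
Proof.
apply: smooth_on_local => p0 p00; have [r0 [t0 [r00 p0E _]]] := polar p00.
have oT : open [set: plane] by exact: openT.
have oR : open [set: R] by exact: openT.
(* Rotating by [- t0] brings [p0] to the positive real axis; on the half-plane x > 0 a branch of the
   argument is t0 + atan (y / x). *)
pose x (p : plane) := turn (- t0) p 0 0; pose y (p : plane) := turn (- t0) p 0 1.
have sturn : smooth_on setT (fun p : plane => turn (- t0) p).
  by apply: smooth_turn => //; [exact: smooth_on_cst|exact: smooth_on_id].
have sx : smooth_on setT x by exact: smooth_on_coord.
have sy : smooth_on setT y by exact: smooth_on_coord.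
pose U := [set p | 0 < x p].
have oU : open U.
  have := open_preimage_smooth oT (@open_gt R 0) sx.
  by rewrite setTI.
have sxU : smooth_on U x by exact: sub_smooth_on sx.
have syU : smooth_on U y by exact: sub_smooth_on sy.
exists U.
  rewrite /U /= /x p0E turnZ turn_cis addNr mxE cisE cos0 mulr1.
  exact: r00.
apply: (eq_smooth_on oU (F := fun p => u (t0 + atan (y p / x p)))).
  move=> p xp; rewrite /U /= in xp.
  set s := atan _.
  have cs : 0 < cos s by apply: cos_gt0_pihalf; rewrite atan_gtNpi2 atan_ltpi2.
  have ts : sin s / cos s = y p / x p by have := atanK (y p / x p); rewrite /tan.
  have -> : p = (x p / cos s) *: cis (t0 + s).
    rewrite -turn_cis -turnZ -[LHS](turn0) -(subrr t0) turnD; congr turn.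
    have E : y p = x p * (sin s / cos s) by rewrite ts mulrC divfK // gt_eqF.
    apply: plane_eq; rewrite [RHS]mxE cisE -?/(x p) -?/(y p).
      by rewrite divfK // gt_eqF.
    by rewrite E mulrA mulrAC.
  by rewrite angle_shiftE // divr_gt0.
apply: (smooth_on_comp (U' := setT) (F := fun p => t0 + atan (y p / x p)) (G := u)) => //.
apply: smooth_onD => //; first exact: smooth_on_cst.
apply: (smooth_on_comp (U' := setT) (F := fun p => y p / x p) (G := @atan R)) => //.
  apply: smooth_onM => //; apply: smooth_onV => //.
  by move=> p xp; rewrite gt_eqF.
exact: smooth_atan.
Qed.

Definition twist_angle (p : plane) : R := step (sqn p) * angle_shift p.

Lemma smooth_twist_angle : smooth_on setT twist_angle.
Proof.
have oT : open [set: plane] by exact: openT.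
have oR : open [set: R] by exact: openT.
have ss : smooth_on setT (fun p : plane => step (sqn p)).
  apply: (smooth_on_comp (U' := setT) (F := @sqn R) (G := @step R)) => //.
    exact: smooth_sqn.
  exact: smooth_step.
apply: smooth_on_local => p _.
(* For |p|^2 < 1/4 the step annihilates the angle; away from the origin both factors are smooth. *)
have [p0|p0] := ltP (sqn p) (1 / 4).
  have oU : open [set p : plane | sqn p < 1 / 4].
    have := open_preimage_smooth oT (@open_lt R (1 / 4)) (@smooth_sqn R).
    by rewrite setTI.
  exists [set p : plane | sqn p < 1 / 4] => //.
  apply: (eq_smooth_on oU (F := fun=> 0)); last exact: smooth_on_cst.
  by move=> q /= q0; rewrite /twist_angle step_eq0 ?mul0r // ltW.
have oU : open [set p : plane | p != 0].
  have := open_preimage_smooth oT (@open_gt R 0) (@smooth_sqn R).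
  rewrite setTI; congr open; apply/seteqP; split=> q /=.
    by apply: contraTneq => ->; rewrite sqn0 ltxx.
  exact: sqn_gt0.
exists [set p | p != 0].
  by apply: contraTneq p0 => ->; rewrite -ltNge sqn0; lra.
apply: smooth_onM => //; first exact: sub_smooth_on ss.
exact: smooth_angle_shift.
Qed.

Lemma twist_angle_polar r t : 0 < r -> twist_angle (r *: cis t) = step (r ^+ 2) * u t.
Proof. by move=> r0; rewrite /twist_angle angle_shiftE // sqnZ sqn_cis mulr1. Qed.

(** The vector i p is tangent to the circle through [p]. The step is constant along that circle, so
    only the derivative of [u] contributes. *)
Lemma diff_twist_angle_polar r t : 0 < r ->
  'd twist_angle (r *: cis t) (rot (r *: cis t)) = step (r ^+ 2) * (dphi t - 1).
Proof.
move=> r0; set p := r *: cis t.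
have ds : differentiable twist_angle (turn 0 p).
  exact: (smooth_on_differentiable smooth_twist_angle).
have := is_derive_comp (is_derive_turn 0 p) ds; rewrite turn0 => -[_ <-].
have -> : (fun s => twist_angle (turn s p)) = (fun s => step (r ^+ 2) * u (s + t)).
  by apply/funext => s; rewrite /p turnZ turn_cis twist_angle_polar.
have Dst : is_derive (0 : R) 1 (fun s => s + t) (1 + 0).
  exact: (is_deriveD (is_derive_id 0 (1 : R)) (is_derive_cst t 0 (1 : R))).
have du : is_derive (0 + t) 1 u (dphi t - 1) by rewrite add0r.
have Du := @is_derive1_comp R u (fun s => s + t) 0 _ _ du Dst.
have [_ ->] := is_deriveM (is_derive_cst (step (r ^+ 2)) 0 (1 : R)) Du.
by rewrite /GRing.scale /=; ring.
Qed.

Definition twist (t : R) (p : plane) : plane := turn (t * twist_angle p) p.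

(** Equals (1 - s) x + s phi x. *)
Definition interp (s x : R) : R := x + s * u x.

Lemma twist_polar t r x : 0 < r ->
  twist t (r *: cis x) = r *: cis (interp (t * step (r ^+ 2)) x).
Proof.
by move=> r0; rewrite /twist twist_angle_polar // turnZ turn_cis addrC mulrA.
Qed.

Lemma twist0 t : twist t 0 = 0.
Proof. by rewrite /twist -(scale0r 0) turnZ !scale0r. Qed.

Lemma sqn_twist t p : sqn (twist t p) = sqn p.
Proof. exact: sqn_turn. Qed.

(** Time is a variable here, as the isotopy has to be smooth on the cylinder. *)
Lemma smooth_twist2 : smooth_on setT (fun pt : plane * R => twist pt.2 pt.1).
Proof.
have oT : open [set: (plane * R)%type] by exact: openT.
have oP : open [set: plane] by exact: openT.
have s1 : smooth_on [set: (plane * R)%type] (fun pt => pt.1).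
  apply: (smooth_on_linear (L := fst_lin plane R)) => //; first exact: fst_lin_continuous.
  exact: smooth_on_id.
have s2 : smooth_on [set: (plane * R)%type] (fun pt => pt.2).
  apply: (smooth_on_linear (L := snd_lin plane R)) => //; first exact: snd_lin_continuous.
  exact: smooth_on_id.
apply: smooth_turn => //; apply: smooth_onM => //.
apply: (smooth_on_comp (U' := setT) (F := fun pt : plane * R => pt.1) (G := twist_angle)) => //.
exact: smooth_twist_angle.
Qed.

Let smooth_tshift t : smooth_on setT (fun p => t * twist_angle p).
Proof.
have oP : open [set: plane] by exact: openT.
by apply: smooth_onM => //; [exact: smooth_on_cst|exact: smooth_twist_angle].
Qed.

Lemma smooth_twist t : smooth_on setT (twist t).
Proof.
have oP : open [set: plane] by exact: openT.
by apply: smooth_turn => //; exact: smooth_on_id.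
Qed.

(** This quantity is both the Jacobian determinant and, on the unit circle, the angular speed, so
    one estimate yields both orientation conditions. It is 1 at the origin and (1 - s) + s dphi
    elsewhere, with s = t step(r^2) in [0, 1]. *)
Let diff_tshift_gt0 t p : 0 <= t <= 1 ->
  0 < 1 + 'd (fun q => t * twist_angle q) p (rot p).
Proof.
move=> t01.
have ds : differentiable twist_angle p by exact: (smooth_on_differentiable smooth_twist_angle).
have -> : 'd (fun q => t * twist_angle q) p (rot p) = t * 'd twist_angle p (rot p).
  exact: (congr1 (fun D : _ -> _ => D (rot p)) (diffZ t ds)).
have [->|p0] := eqVneq p 0.
  have -> : rot (0 : plane) = 0 by apply: plane_eq; rewrite !rotE !mxE ?oppr0.
  by rewrite linear0 mulr0 addr0.
have [r [x [r0 -> _]]] := polar p0.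
rewrite diff_twist_angle_polar // mulrA; set s := t * step _.
have s0 : 0 <= s by case/andP: t01 => t0 _; rewrite mulr_ge0 // step_ge0.
have s1 : s <= 1.
  case/andP: t01 => t0 t1; rewrite (le_trans (ler_wpM2l t0 (step_le1 _))) //.
  by rewrite mulr1.
have d0 := dphi_gt0 x.
rewrite (_ : 1 + _ = (1 - s) + s * dphi x); last by ring.
move: s0; rewrite le_eqVlt => /predU1P[<-|s0]; first by rewrite subr0 mul0r addr0.
by rewrite ltr_wpDl ?subr_ge0 // mulr_gt0.
Qed.

Lemma twist_crossp_gt0 t p : 0 <= t <= 1 ->
  0 < crossp ('d (twist t) p (delta_mx 0 0)) ('d (twist t) p (delta_mx 0 1)).
Proof.
move=> t01; have := diff_tshift_gt0 p t01.
by rewrite -(crossp_diff_turn p (smooth_tshift t)).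
Qed.

Lemma twist_speed_gt0 t p : 0 <= t <= 1 -> sqn p = 1 ->
  0 < dotp ('d (twist t) p (rot p)) (rot (twist t p)).
Proof.
move=> t01 p1; have := diff_tshift_gt0 p t01.
have E := diff_turn_rot p (smooth_tshift t); rewrite -/(twist t) -/(twist t p) in E.
have -> : dotp ('d (twist t) p (rot p)) (rot (twist t p)) =
    1 + 'd (fun q => t * twist_angle q) p (rot p).
  apply: etrans (congr1 (fun v => dotp v _) E) _.
  by rewrite dotpZl rot_dot sqn_twist p1 mulr1.
by [].
Qed.

Lemma interp_lt s : 0 <= s <= 1 -> {homo interp s : x y / x < y}.
Proof.
case/andP=> s0 s1; apply: (pos_derive_lt (df := fun x => (1 - s) + s * dphi x)) => x.
  have := is_deriveD (is_derive_id x (1 : R)) (is_deriveZ s (is_derive_u x)).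
  by move=> H; apply: is_derive_eq H _; rewrite /GRing.scale /=; ring.
have d0 := dphi_gt0 x.
move: s0; rewrite le_eqVlt => /predU1P[<-|s0]; first by rewrite subr0 mul0r addr0.
by rewrite ltr_wpDl ?subr_ge0 // mulr_gt0.
Qed.

Lemma interp_tau s (k : int) x : interp s (x + k%:~R * tau) = interp s x + k%:~R * tau.
Proof. by rewrite /interp u_periodic addrAC. Qed.

Lemma cis_interp_inj s x y : 0 <= s <= 1 ->
  cis (interp s x) = cis (interp s y) -> cis x = cis y.
Proof.
move=> s01 /cis_inj[k]; rewrite -interp_tau => E.
suff -> : x = y + k%:~R * tau by exact: cis_periodic.
have mono := interp_lt s01.
have [xy|xy|//] := ltgtP x (y + k%:~R * tau).
  by have := mono _ _ xy; rewrite E ltxx.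
by have := mono _ _ xy; rewrite E ltxx.
Qed.

Lemma cis_interp_surj s y : exists x, cis (interp s x) = cis y.
Proof.
have t0 := tau_gt0 R; have i1 := interp_tau s 1 0; rewrite add0r mul1r in i1.
(* Subtracting [k] periods places [y] between [interp s 0] and [interp s tau], where the
   intermediate value theorem applies. *)
pose k := Num.floor ((y - interp s 0) / tau).
have /andP[k1 k2] := floor_itv ((y - interp s 0) / tau); rewrite -/k in k1 k2.
rewrite ler_pdivlMr // in k1; rewrite ltr_pdivrMr // (intrD _ k 1) mulrDl mul1r in k2.
have [|||x _ xE] := @IVT R (interp s) 0 tau (y - k%:~R * tau).
- exact: ltW.
- have oT : open [set: R] by exact: openT.
  apply/continuous_subspaceT/smooth_continuous.
  apply: smooth_onD => //; first exact: smooth_on_id.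
  by apply: smooth_onM => //; exact: smooth_on_cst.
- by rewrite i1 ge_min le_max; apply/andP; split; apply/orP; [left|right]; lra.
by exists x; rewrite xE -[RHS](cis_periodic (- k)) mulrNz mulNr.
Qed.

Let step01 (t r : R) : 0 <= t <= 1 -> 0 <= t * step r <= 1.
Proof.
case/andP=> t0 t1; rewrite mulr_ge0 ?step_ge0 //=.
by rewrite (le_trans (ler_wpM2l t0 (step_le1 _))) // mulr1.
Qed.

Lemma twist_inj t : 0 <= t <= 1 -> injective (twist t).
Proof.
move=> t01 p q E; have sE : sqn p = sqn q by rewrite -(sqn_twist t p) E sqn_twist.
have z0 (v : plane) : sqn v = 0 -> v = 0.
  by apply: contra_eq => /sqn_gt0 /lt0r_neq0.
have [p0|p0] := eqVneq p 0.
  by rewrite p0; apply/esym/z0; rewrite -sE p0 sqn0.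
have q0 : q != 0 by apply: contraNneq p0 => q0; apply/eqP/z0; rewrite sE q0 sqn0.
have [r [x [r0 pE _]]] := polar p0; have [r' [x' [r'0 qE _]]] := polar q0.
move: E; rewrite pE qE !twist_polar // => /(polar_uniq r0 r'0)[<-].
by move/(cis_interp_inj (step01 _ t01)) => ->.
Qed.

Lemma twist_surj t q : exists p, twist t p = q.
Proof.
have [->|q0] := eqVneq q 0; first by exists 0; exact: twist0.
have [r [y [r0 qE _]]] := polar q0.
have [x xE] := cis_interp_surj (t * step (r ^+ 2)) y.
by exists (r *: cis x); rewrite twist_polar // xE.
Qed.

Lemma twist_inverse t : 0 <= t <= 1 -> exists g' : plane -> plane,
  [/\ cancel (twist t) g', cancel g' (twist t), smooth_on setT g' &
      forall p, sqn (g' p) = sqn p].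
Proof.
move=> t01; have [g' g'K] := choice (twist_surj t).
have gK := inj_can_sym g'K (twist_inj t01).
have sg p : sqn (g' p) = sqn p by rewrite -(sqn_twist t) g'K.
exists g'; split=> //; apply: (smooth_inverse (smooth_twist t)) => //.
  exact: (inverse_continuous (smooth_continuous (smooth_twist t))).
by move=> x; rewrite gt_eqF // twist_crossp_gt0.
Qed.

End RadialExtension.

(** * Every circle diffeomorphism is a boundary value *)

Section Surjectivity.
Variable R : realType.
Notation plane := 'rV[R]_2.

Lemma jacobian_entry (K : numFieldType) m n (F : 'rV[K]_m -> 'rV[K]_n) p i j :
  jacobian F p i j = 'd F p (delta_mx 0 i) 0 j.
Proof. by rewrite /jacobian mxE. Qed.

Lemma det_jacobian (F : plane -> plane) p :
  \det (jacobian F p) = crossp ('d F p (delta_mx 0 0)) ('d F p (delta_mx 0 1)).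
Proof.
have E i j := jacobian_entry F p i j.
move: (jacobian F p) ('d F p (delta_mx 0 0)) ('d F p (delta_mx 0 1)) (E 0) (E 1).
move=> M a b Ea Eb; rewrite /crossp -!Ea -!Eb.
rewrite (expand_det_row _ 0) !big_ord_recl big_ord0 /cofactor !det_mx11 !mxE /= addr0.
have -> : lift 0 0 = 1 :> 'I_2 by exact: val_inj.
have -> : lift 1 0 = 0 :> 'I_2 by exact: val_inj.
by rewrite expr0 expr1; ring.
Qed.

Lemma restrict_sym (A : set plane) (g g' : plane -> plane) :
  cancel g g' -> cancel g' g -> (forall p, A p -> A (g p)) ->
  (forall p, A p -> A (g' p)) ->
  exists s : sym A, (forall x, set_val (s x) = g (set_val x)) /\
    (forall x, set_val (sym_inv s x) = g' (set_val x)).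
Proof.
move=> gK g'K Ag Ag'.
pose r (h : plane -> plane) (Ah : forall p, A p -> A (h p)) (x : A) : A :=
  SigSub (mem_set (Ah _ (set_valP x))).
have rK : cancel (r g Ag) (r g' Ag') by move=> x; apply: val_inj; exact: gK.
have r'K : cancel (r g' Ag') (r g Ag) by move=> x; apply: val_inj; exact: g'K.
by exists (Sym rK r'K).
Qed.

Lemma restrict_diffeo (A : set plane) (s : sym A) (g g' : plane -> plane) :
  smooth_on setT g -> smooth_on setT g' ->
  (forall x, set_val (s x) = g (set_val x)) ->
  (forall x, set_val (sym_inv s x) = g' (set_val x)) -> diffeo s.
Proof.
by move=> sg sg' sE s'E; split=> x; [exists g|exists g']; exact: smooth_global.
Qed.

Lemma restricts_surj f : Diffp_circle R f ->
  exists2 g, Diff_ar0 R g & restricts_to_circle g f.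
Proof.
move=> pf; have [phi [dphi [sphi dphiE dphi0 lift phiT]]] := circle_lift_exists pf.
pose G t := twist phi t.
have sG t : smooth_on setT (G t) by exact: (smooth_twist sphi phiT).
(* Any set described by the norm alone is invariant under the twists and their inverses, so disc and
   circle are treated together. *)
have onA (A : set plane) (Q : R -> Prop) : A = [set p | Q (sqn p)] ->
    forall t, 0 <= t <= 1 -> exists s : sym A, diffeo s /\
      (forall x, set_val (s x) = G t (set_val x)).
  move=> -> t t01.
  have [g' [gK g'K sg' ng']] := twist_inverse sphi dphiE dphi0 phiT t01.
  have [||s [sE s'E]] := @restrict_sym [set p | Q (sqn p)] _ _ gK g'K.
  - by move=> p /=; rewrite sqn_twist.
  - by move=> p /=; rewrite ng'.
  by exists s; split=> //; exact: restrict_diffeo sE s'E.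
have onD := onA (cdisc R) (fun r => r <= 1) erefl.
have onC := onA (circle R) (fun r => r = 1) erefl.
have [H HP] := choice (fun t : @unit_interval R => onD (set_val t) (set_valP t)).
have HE t x : set_val (H t x) = G (set_val t) (set_val x) by exact: (HP t).2.
have arH t : Diff_ar (H t).
  have t01 : 0 <= set_val t <= 1 by exact: (set_valP t).
  split.
    apply: Diffp_disc_intro => [|x]; first exact: (HP t).1.
    exists (G (set_val t)); first exact: smooth_global.
    rewrite det_jacobian; exact: (twist_crossp_gt0 sphi dphiE dphi0 phiT).
  have [k [dk kE]] := onC _ t01.
  (* For r > 3/4 one has r^2 >= 9/16 >= 1/2, where the step is 1: on this collar the twist acts on
     angles exactly as it does at radius 1. *)
  exists (1 / 4), k; split; first by lra.
    apply: Diffp_circle_intro => // z.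
    exists (G (set_val t)); first exact: smooth_global.
    rewrite kE; apply: (twist_speed_gt0 sphi dphiE dphi0 phiT) => //.
    exact: (set_valP z).
  move=> r /andP[r0 r1] x z xz; rewrite HE kE xz.
  have [a ->] := circle_polar (set_valP z : sqn (set_val z) = 1).
  have rp : 0 < r by lra.
  rewrite /G twist_polar // -[X in _ = _ *: twist _ _ X]scale1r twist_polar //.
  rewrite scale1r !step_eq1 //; first by lra.
  have : 3 / 4 * (3 / 4) <= r * r by apply: ler_pM; lra.
  by rewrite expr2; lra.
have i1 : @unit_interval R 1 by rewrite /unit_interval /= ler01 lexx.
have [one oneE] := set_valE i1.
exists (H one).
  split=> //; exists H; split=> //.
  - move=> xt; exists (fun pt : plane * R => G pt.2 pt.1); apply: smooth_global.
      exact: (smooth_twist2 sphi phiT).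
    by move=> y; rewrite HE.
  - move=> t t0; apply: sym_eq => x; apply: val_inj; rewrite [LHS]HE t0.
    by rewrite /G /twist mul0r turn0.
  - by move=> t t1; congr H; apply: val_inj; rewrite [LHS]t1 [RHS]oneE.
move=> x z xz; rewrite HE oneE xz.
have [a zE] := circle_polar (set_valP z : sqn (set_val z) = 1).
have -> : z = circle_cis a by apply: val_inj.
rewrite lift circle_cisE /G -[X in twist _ _ X]scale1r twist_polar // scale1r.
rewrite step_eq1 ?expr1n; last by lra.
(* At time 1 and radius 1 the weight is 1, and the convex combination is [phi] itself. *)
by rewrite /interp mulr1 mul1r addrC subrK.
Qed.

End Surjectivity.

(** * The quotient isomorphism *)

Theorem proposition3p9 (R : realType) :
  let G : set (sym (cdisc R)) := Diff_ar0 R in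
  let H : set (sym (cdisc R)) := boundary_fixing R in
  [/\ subgroup G,
      subgroup (Diffp_circle R),
      normal_subgroup H G,
      closed_in G H &
      exists Phi : set (sym (cdisc R)) -> sym (circle R),
        [/\ forall g, G g -> restricts_to_circle g (Phi (left_coset g H)),
            set_bij (quotient_set G H) (Diffp_circle R) Phi &
            forall A B, quotient_set G H A -> quotient_set G H B ->
              quotient_set G H (setmul A B) /\
              Phi (setmul A B) = (Phi A * Phi B)%g]].
Proof.
move=> G H.
have nH : normal_subgroup H G := normal_boundary_fixing R.
have [sH HG nor] := nH.
have H1 : H 1%g by case: sH => /set_mem.
have HM x y : H x -> H y -> H (x * y)%g.
  move=> Hx Hy; apply/set_mem/(group_closedM sH); exact/mem_set.
have HV x : H x -> H x^-1%g.
  by move=> Hx; apply/set_mem/(group_closedV sH); exact/mem_set.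
split=> //; [exact: subgroup_Diff_ar0|exact: subgroup_Diffp_circle
  |exact: closed_boundary_fixing|].
(* All members of a coset have the same restriction, so the choice is immaterial; the default 1 is
   never taken on a coset of an element of [G]. *)
pose Phi (A : set (sym (cdisc R))) : sym (circle R) :=
  xget 1%g [set f | exists2 g, A g & restricts_to_circle g f].
have coset_self g : left_coset g H g by exists 1%g => //; rewrite mulg1.
have rest_coset g f : G g -> restricts_to_circle g f ->
    forall k, left_coset g H k -> restricts_to_circle k f.
  move=> Gg rf k [n Hn <-]; rewrite -(mulg1 f); apply: restrictsM => //.
  by apply/restricts1_boundary => //; exact: HG.
have PhiE g f : G g -> restricts_to_circle g f -> Phi (left_coset g H) = f.
  move=> Gg rf; rewrite /Phi; set P := [set _ | _].
  have [|k gk rk] := @xgetPex _ 1%g P; first by exists f, g.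
  exact: restricts_uniq rk (rest_coset _ _ Gg rf _ gk).
have coset_eq g h f : G g -> G h -> restricts_to_circle g f ->
    restricts_to_circle h f -> left_coset g H = left_coset h H.
  have half a b : G a -> G b -> restricts_to_circle a f ->
      restricts_to_circle b f -> left_coset a H `<=` left_coset b H.
    (* Injectivity: a n = b (b^-1 a n), and b^-1 a fixes the boundary because [a] and [b] have the
       same restriction. *)
    move=> Ga Gb ra rb k [n Hn <-]; exists (b^-1 * a * n)%g.
      by apply: HM => //; exact: boundary_fixing_quotient rb ra.
    by rewrite !mulgA mulgV mul1g.
  by move=> Gg Gh rg rh; apply/seteqP; split; exact: half.
have mulE g h : G g -> G h ->
    setmul (left_coset g H) (left_coset h H) = left_coset (g * h)%g H.
  move=> Gg Gh; apply/seteqP; split=> k.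
    move=> [_ [n Hn <-]] [_ [m Hm <-]] <-.
    (* From g n h m = (g h) (h^-1 n h m); normality is applied to h^-1. *)
    exists (h^-1 * n * h * m)%g; last by rewrite !mulgA mulgK.
    apply: HM => //; have := nor (h^-1)%g n (Diff_ar0V Gh) Hn.
    by rewrite invgK.
  move=> [n Hn <-]; exists g => //; exists (h * n)%g; first by exists n.
  by rewrite mulgA.
exists Phi; split.
- by move=> g Gg; have [f _ rf] := Diff_ar0_restricts Gg; rewrite (PhiE g f).
- split.
  + move=> _ [g Gg <-]; have [f pf rf] := Diff_ar0_restricts Gg.
    by rewrite (PhiE g f).
  + move=> A B /set_mem[g Gg <-] /set_mem[h Gh <-].
    have [f _ rf] := Diff_ar0_restricts Gg; have [k _ rk] := Diff_ar0_restricts Gh.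
    rewrite (PhiE g f) // (PhiE h k) // => fk; rewrite -fk in rk.
    exact: coset_eq rf rk.
  + move=> f /restricts_surj[g Gg rf]; exists (left_coset g H); first by exists g.
    exact: PhiE.
move=> _ _ [g Gg <-] [h Gh <-]; rewrite mulE //.
have [f _ rf] := Diff_ar0_restricts Gg; have [k _ rk] := Diff_ar0_restricts Gh.
have Ggh := Diff_ar0M Gg Gh.
split; first by exists (g * h)%g.
by rewrite (PhiE g f) // (PhiE h k) // (PhiE _ (f * k)%g) //; exact: restrictsM.
Qed.
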